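(* Let $n$ be even. In any operational theory admitting a preparation-noncontextual ontological (hidden-variable) model, every parity-oblivious protocol for $\mathrm{HM}_n$ has success probability $$p_{\mathrm{succ}}\le \frac12+\frac{9}{\sqrt{n-1}} .$$ Furthermore this scaling is optimal up to a constant factor: the supremum $p^{\mathrm{NC}}_{\mathrm{opt}}(n)$ of the success probability over all such theories and protocols satisfies $p^{\mathrm{NC}}_{\mathrm{opt}}(n)=\frac12+\Theta(n^{-1/2})$ as $n\to\infty$ over even integers.
   Context: Operational theory: a set of preparations and a set of measurements with, for each preparation $P$ and measurement $M$, a probability distribution $p(k\mid P,M)$ over the outcomes $k$ of $M$. Probabilistic mixtures of preparations are again preparations, with the corresponding mixed statistics. Ontological model: a measurable space $\Lambda$; for each preparation $P$ a probability measure $\mu_P$ on $\Lambda$; for each measurement $M$ and outcome $k$ a measurable response function $\xi(k\mid\cdot,M):\Lambda\to[0,1]$ with $\sum_k\xi(k\mid\lambda,M)=1$; such that $p(k\mid P,M)=\int_\Lambda\xi(k\mid\lambda,M)\,d\mu_P(\lambda)$. A mixture $P=\sum_\alpha w_\alpha P_\alpha$ has $\mu_P=\sum_\alpha w_\alpha\mu_{P_\alpha}$. Preparations $P,P'$ are operationally equivalent if $p(k\mid P,M)=p(k\mid P',M)$ for all $M,k$; the model is preparation noncontextual if operationally equivalent preparations have $\mu_P=\mu_{P'}$. $[n]=\{1,\dots,n\}$; $x_S=\bigoplus_{i\in S}x_i$; $\mathscr M_n$ is the set of perfect matchings of $[n]$ (sets of $n/2$ disjoint pairs covering $[n]$); $\mathcal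 F_n=\{S\subseteq[n]:|S|\ne0,2\}$. A protocol for $\mathrm{HM}_n$ in an operational theory consists of a preparation $P_x$ for each $x\in\{0,1\}^n$ and, for each $\mathtt M\in\mathscr M_n$, a measurement with outcomes $(\{i,j\},b)$, $\{i,j\}\in\mathtt M$, $b\in\{0,1\}$; the output is correct if $b=x_i\oplus x_j$. It is parity-oblivious if for all $S\in\mathcal F_n$, all measurements $M$ of the theory and outcomes $k$, $p(k\mid P_{S,0},M)=p(k\mid P_{S,1},M)$, where $P_{S,b}$ samples $x$ uniformly from $\{x:x_S=b\}$ and implements $P_x$. The success probability is the probability of a correct output when $x$ is uniform on $\{0,1\}^n$ and $\mathtt M$ is independent and uniform on $\mathscr M_n$. ($\mathrm{PoHM}_n$ denotes $\mathrm{HM}_n$ under parity-obliviousness.) *)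

(* Defs.v *)
From HB Require Import structures.
From mathcomp Require Import all_boot all_order all_algebra.
From mathcomp Require Import all_classical all_reals all_analysis.

Set Implicit Arguments.
Unset Strict Implicit.
Unset Printing Implicit Defensive.

Import Order.TTheory GRing.Theory Num.Theory.

Local Open Scope ring_scope.

Record fdist (R : realType) (I : finType) := FDist {
  weight :> I -> R;
  weight_ge0 : forall i, 0 <= weight i;
  weight_sum1 : \sum_i weight i = 1 }.

Section Uniform.
Variables (R : realType) (I : finType) (A : {set I}).
Hypothesis A_neq0 : A != finset.set0.

Definition uniform_weight (i : I) : R := (i \in A)%:R / #|A|%:R.

Lemma uniform_weight_ge0 i : 0 <= uniform_weight i.
Proof. by rewrite /uniform_weight divr_ge0 ?ler0n. Qed.

Lemma uniform_weight_sum1 : \sum_i uniform_weight i = 1.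
Proof.
rewrite /uniform_weight -mulr_suml -natr_sum -big_mkcond sum1_card divff //.
by rewrite pnatr_eq0 cards_eq0.
Qed.

Definition uniform_on : fdist R I :=
  FDist uniform_weight_ge0 uniform_weight_sum1.

End Uniform.

(* Outcome sets are discrete but otherwise arbitrary, whence the unordered
   sum [esum].  [mix w P] is the preparation "sample i from w, implement P i". *)
Record op_theory (R : realType) := OpTheory {
  prep : Type;
  meas : Type;
  outcome : meas -> choiceType;
  prob : prep -> forall M : meas, outcome M -> R;
  prob_ge0 : forall P M k, 0 <= prob P (M := M) k;
  prob_sum1 : forall P M,
    (\esum_(k in [set: outcome M]%classic) (prob P k)%:E = 1)%E;
  mix : forall I : finType, fdist R I -> (I -> prep) -> prep;
  prob_mix : forall (I : finType) (w : fdist R I) (P : I -> prep) M k,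
    prob (mix w P) (M := M) k = \sum_i w i * prob (P i) k }.

Arguments prob {R} o P {M} k.

Definition op_equiv (R : realType) (T : op_theory R) (P P' : prep T) : Prop :=
  forall (M : meas T) (k : outcome M), prob T P k = prob T P' k.

Record ont_model (R : realType) (T : op_theory R) := OntModel {
  ont_display : measure_display;
  ont_space : measurableType ont_display;
  ont_mu : prep T -> probability ont_space R;
  ont_xi : forall M : meas T, outcome M -> ont_space -> R;
  ont_xi_measurable : forall M k,
    measurable_fun [set: ont_space]%classic (ont_xi (M := M) k);
  ont_xi_itv : forall M k l, 0 <= ont_xi (M := M) k l <= 1;
  ont_xi_sum1 : forall M l,
    (\esum_(k in [set: outcome M]%classic) (ont_xi k l)%:E = 1)%E;
  ont_prob : forall P M (k : outcome M),
    ((prob T P k)%:E = \int[ont_mu P]_(l in [set: ont_space]%classic) (ont_xi k l)%:E)%E;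
  ont_mu_mix : forall (I : finType) (w : fdist R I) (P : I -> prep T)
      (A : set ont_space), measurable A ->
    (ont_mu (mix w P) A = \sum_i (w i)%:E * ont_mu (P i) A)%E }.

(* Measures are compared on measurable sets only: a library measure is a total
   function on [set T], with meaningless values elsewhere. *)
Definition prep_noncontextual (R : realType) (T : op_theory R)
    (O : ont_model T) : Prop :=
  forall P P' : prep T, op_equiv P P' ->
    forall A : set (ont_space O), measurable A -> ont_mu O P A = ont_mu O P' A.

Definition admits_nc_model (R : realType) (T : op_theory R) : Prop :=
  exists O : ont_model T, prep_noncontextual O.

Definition bits (n : nat) : finType := {ffun 'I_n -> bool}.

Definition parity (n : nat) (x : bits n) (S : {set 'I_n}) : bool :=
  \big[addb/false]_(i in S) x i.

Definition perfect_matching (n : nat) (Mt : {set {set 'I_n}}) : bool :=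
  finset.partition Mt [set: 'I_n] && [forall e in Mt, #|e| == 2%N].

Definition matching (n : nat) : finType :=
  {Mt : {set {set 'I_n}} | perfect_matching Mt}.

Definition edge (n : nat) (Mt : matching n) : finType :=
  {e : {set 'I_n} | e \in val Mt}.

Definition oblivious_sets (n : nat) : {set {set 'I_n}} :=
  [set S : {set 'I_n} | (#|S| != 0%N) && (#|S| != 2%N)].

Definition parity_class (n : nat) (S : {set 'I_n}) (b : bool) : {set bits n} :=
  [set x : bits n | parity x S == b].

Lemma parity_class_neq0 (n : nat) (S : {set 'I_n}) (b : bool) :
  S \in oblivious_sets n -> parity_class S b != finset.set0.
Proof.
rewrite inE cards_eq0 => /andP[/finset.set0Pn[i iS] _].
apply/finset.set0Pn; exists [ffun j => b && (j == i)].
rewrite inE /parity (bigD1 i) //= ffunE eqxx andbT big1 ?addbF //.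
by move=> j /andP[_ /negPf ji]; rewrite ffunE ji andbF.
Qed.

Record hm_protocol (R : realType) (T : op_theory R) (n : nat) := HMProtocol {
  hm_prep : bits n -> prep T;
  hm_meas : matching n -> meas T;
  hm_out : forall Mt : matching n, edge Mt * bool -> outcome (hm_meas Mt);
  hm_out_bij : forall Mt : matching n, bijective (@hm_out Mt) }.

Definition prep_parity (R : realType) (T : op_theory R) (n : nat)
    (pr : hm_protocol T n) (S : {set 'I_n}) (hS : S \in oblivious_sets n)
    (b : bool) : prep T :=
  mix (uniform_on R (parity_class_neq0 b hS)) (hm_prep pr).

Definition parity_oblivious (R : realType) (T : op_theory R) (n : nat)
    (pr : hm_protocol T n) : Prop :=
  forall (S : {set 'I_n}) (hS : S \in oblivious_sets n)
    (M : meas T) (k : outcome M),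
    prob T (prep_parity pr hS false) k = prob T (prep_parity pr hS true) k.

(* For an edge e = {i, j}, [parity x e] is x_i (+) x_j. *)
Definition p_succ (R : realType) (T : op_theory R) (n : nat)
    (pr : hm_protocol T n) : R :=
  (#|bits n|%:R * #|matching n|%:R)^-1 *
  \sum_(x : bits n) \sum_(Mt : matching n)
    \sum_(o : edge Mt * bool | o.2 == parity x (val o.1))
      prob T (hm_prep pr x) (hm_out pr o).

Definition p_nc_opt (R : realType) (n : nat) : R :=
  sup [set p : R | exists (T : op_theory R) (pr : hm_protocol T n),
    [/\ admits_nc_model T, parity_oblivious pr & p = p_succ pr]].

(* Main.v *)
(** Upper bound.  Let [v x] be the density at a hidden state of the measure of
    [P_x] with respect to the average measure.  Parity-obliviousness and
    noncontextuality make [v] a nonnegative function on the cube whose Fourier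
    transform lives on sets of size 0 and 2.  Bonami's inequality for degree 2
    bounds [E v^4] by [81 (E v^2)^2], and since [v >= 0], Hoelder turns this into
    [E v^2 <= 81 (E v)^2]: the squared biases of all edges sum to at most 81.
    A random perfect matching contains a given edge with probability
    [1 / (n - 1)], so the best bias available in it is of order [1 / sqrt n].

    Lower bound.  Let [K] be a set of [k ~ sqrt n] vertices and
    [f z = (\sum_(i in K) (-1)^z_i)^2 / k]; the hidden state [y] has law
    [2^-n f(x + y)] under [P_x].  Edges inside [K] then have bias [2 / k], and by
    Bonferroni a random matching contains such an edge with probability bounded
    below. *)
Require Import Defs.
From HB Require Import structures.
From mathcomp Require Import all_boot all_order all_algebra all_fingroup.
From mathcomp Require Import all_classical all_reals all_analysis.
From mathcomp Require Import measurable_realfun zify ring lra.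

Set Implicit Arguments.
Unset Strict Implicit.
Unset Printing Implicit Defensive.

Import Order.TTheory GRing.Theory Num.Theory.

Local Open Scope ring_scope.

(** * Fourier analysis on the cube *)

Section Fourier.
Variables (R : realType) (n : nat).
Implicit Types (x y : bits n) (i : 'I_n) (S U : {set 'I_n}) (v : bits n -> R).

Definition chi S x : R := (-1) ^+ parity x S.

(** Unnormalised, so powers of [2 ^+ n] appear in inversion and in Parseval's identity. *)
Definition fourier v S : R := \sum_x chi S x * v x.

Definition flip i x : bits n := [ffun j => x j (+) (j == i)].

Definition symdiff S U : {set 'I_n} := [set i | (i \in S) (+) (i \in U)].

Definition shift x y : bits n := [ffun j => x j (+) y j].

Lemma chi_prod S x : chi S x = \prod_(i in S) (-1) ^+ x i.
Proof.
rewrite /chi /parity.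
by apply: (big_morph (fun b : bool => (-1 : R) ^+ b)) => // -[] [];
  rewrite ?expr0 ?expr1 ?mulr1 ?mulrNN ?mulr1 ?mul1r.
Qed.

Lemma chi_prodT S x : chi S x = \prod_i (if i \in S then (-1) ^+ x i else 1).
Proof. by rewrite chi_prod big_mkcond. Qed.

Lemma chi0 x : chi finset.set0 x = 1.
Proof. by rewrite chi_prod big_set0. Qed.

Lemma chi_sqr S x : chi S x * chi S x = 1.
Proof. by rewrite /chi -expr2 sqrr_sign. Qed.

Lemma chi_set1 i x : chi [set i] x = (-1) ^+ x i.
Proof. by rewrite chi_prod big_set1. Qed.

Lemma chiM S U x : chi S x * chi U x = chi (symdiff S U) x.
Proof.
rewrite !chi_prodT -big_split; apply: eq_bigr => i _ /=; rewrite inE.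
by case: (i \in S); case: (i \in U); rewrite /= ?mulr1 ?mul1r -?expr2 ?sqrr_sign.
Qed.

Lemma chi_shift S x y : chi S (shift x y) = chi S x * chi S y.
Proof.
rewrite !chi_prod -big_split; apply: eq_bigr => i _ /=.
by rewrite ffunE signr_addb.
Qed.

Lemma chi_setU1 i S x : i \notin S -> chi (i |: S) x = (-1) ^+ x i * chi S x.
Proof. by move=> iS; rewrite !chi_prod big_setU1. Qed.

Lemma flipK i : involutive (flip i).
Proof. by move=> x; apply/ffunP => j; rewrite !ffunE addbK. Qed.

Lemma shiftK y : involutive (shift^~ y).
Proof. by move=> x; apply/ffunP => j; rewrite !ffunE addbK. Qed.

Lemma shiftC x y : shift x y = shift y x.
Proof. by apply/ffunP => j; rewrite !ffunE addbC. Qed.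

Lemma chi_flip i S x : chi S (flip i x) = if i \in S then - chi S x else chi S x.
Proof.
rewrite !chi_prod; case: ifPn => iS.
  rewrite (bigD1 i) //= [in RHS](bigD1 i) //= ffunE eqxx addbT signrN mulNr.
  congr (- (_ * _)); apply: eq_bigr => j /andP[_ /negPf ji].
  by rewrite ffunE ji addbF.
apply: eq_bigr => j jS; rewrite ffunE (negPf (_ : j != i)) ?addbF //.
by apply: contraNneq iS => <-.
Qed.

Lemma sum_flip i v : \sum_x v (flip i x) = \sum_x v x.
Proof.
rewrite [RHS](reindex_inj (h := flip i)) //.
exact: inv_inj (flipK i).
Qed.

Lemma sum_shift y v : \sum_x v (shift x y) = \sum_x v x.
Proof.
rewrite [RHS](reindex_inj (h := shift^~ y)) //.
exact: inv_inj (shiftK y).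
Qed.

(** [flip i] permutes the cube, so the sum equals its own opposite. *)
Lemma sum_odd i v : (forall x, v (flip i x) = - v x) -> \sum_x v x = 0.
Proof.
move=> vN.
have : \sum_x v x = - \sum_x v x.
  rewrite -{1}(sum_flip i) -sumrN; exact: eq_bigr.
by move=> h; lra.
Qed.

Lemma card_bits : #|bits n|%:R = 2 ^+ n :> R.
Proof. by rewrite card_ffun card_bool card_ord natrX. Qed.

Lemma sum_chi S : \sum_x chi S x = if S == finset.set0 then 2 ^+ n else 0.
Proof.
case: (eqVneq S finset.set0) => [->|/finset.set0Pn[i iS]].
  under eq_bigr do rewrite chi0.
  by rewrite sumr_const -card_bits.
by apply: (@sum_odd i) => x; rewrite chi_flip iS.
Qed.

(** Dual orthogonality: the sum over [S] factors into one term [(-1) ^+ shift x y i + 1] per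
    coordinate, and a coordinate where [x] and [y] differ kills the product. *)
Lemma sum_chi_index x y :
  \sum_S chi S x * chi S y = if x == y then 2 ^+ n else 0.
Proof.
under eq_bigr do rewrite -chi_shift chi_prodT.
have -> : \sum_(S : {set 'I_n}) \prod_i (if i \in S then (-1) ^+ shift x y i else 1)
    = \prod_i ((-1) ^+ shift x y i + 1) :> R by rewrite bigA_distr.
case: eqP => [->|/eqP xy].
  under eq_bigr do rewrite ffunE addbb expr0 -(natrD _ 1 1).
  by rewrite prodr_const card_ord.
have [i xyi] : exists i, x i != y i.
  apply/existsP; apply: contraNT xy; rewrite negb_exists => /forallP h.
  by apply/eqP/ffunP => i; apply/eqP; move: (h i); rewrite negbK.
rewrite (bigD1 i) //= ffunE.
have -> : x i (+) y i = true by move: xyi; case: (x i); case: (y i).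
by rewrite expr1 addNr mul0r.
Qed.

Lemma fourier_inversion v x : 2 ^+ n * v x = \sum_S chi S x * fourier v S.
Proof.
under eq_bigr => S _ do rewrite /fourier mulr_sumr.
rewrite exchange_big /= (bigD1 x) //= [X in _ + X]big1 ?addr0.
  by under eq_bigr do rewrite mulrA; rewrite -mulr_suml sum_chi_index eqxx.
move=> y /negPf yx; under eq_bigr do rewrite mulrA.
by rewrite -mulr_suml sum_chi_index eq_sym yx mul0r.
Qed.

Lemma parseval v : \sum_S fourier v S ^+ 2 = 2 ^+ n * \sum_x v x ^+ 2.
Proof.
rewrite mulr_sumr.
under [RHS]eq_bigr => x _ do rewrite expr2 mulrA fourier_inversion mulr_suml.
rewrite exchange_big /=; apply: eq_bigr => S _.
by rewrite expr2 {1}/fourier mulr_suml; apply: eq_bigr => x _; rewrite mulrAC.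
Qed.

(** Degree at most [d] in the variables of [U]. The set [U] is carried along because Bonami's
    inequality goes by induction on its size. *)
Definition lowdeg (d : nat) U v := exists a : {set 'I_n} -> R, forall x,
  v x = \sum_(S : {set 'I_n} | (S \subset U) && (#|S| <= d)%N) a S * chi S x.

Lemma lowdeg_flip d U v i x : lowdeg d U v -> i \notin U -> v (flip i x) = v x.
Proof.
move=> [a va] iU; rewrite !va; apply: eq_bigr => S /andP[SU _].
rewrite chi_flip ifN //; apply: contra iU; exact: (fintype.subsetP SU).
Qed.

Lemma lowdeg0 d v : lowdeg d finset.set0 v -> forall x y, v x = v y.
Proof.
move=> [a va] x y; rewrite !va; apply: eq_bigr => S /andP[].
by rewrite finset.subset0 => /eqP-> _; rewrite !chi0.
Qed.

Lemma lowdeg_deg0 U v : lowdeg 0 U v -> forall x y, v x = v y.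
Proof.
move=> [a va] x y; rewrite !va; apply: eq_bigr => S /andP[_].
by rewrite leqn0 cards_eq0 => /eqP->; rewrite !chi0.
Qed.

(** The characters whose set contains [i] factor through [chi [set i]], which lowers their degree by
    one; the others form [h]. *)
Lemma lowdeg_split d U v i : lowdeg d.+1 U v -> i \in U ->
  exists g h, [/\ lowdeg d (U :\ i) g, lowdeg d.+1 (U :\ i) h &
    forall x, v x = h x + chi [set i] x * g x].
Proof.
move=> [a va] iU.
exists (fun x => \sum_(S : {set 'I_n} | (S \subset U :\ i) && (#|S| <= d)%N)
   a (i |: S) * chi S x).
exists (fun x => \sum_(S : {set 'I_n} | (S \subset U :\ i) && (#|S| <= d.+1)%N)
   a S * chi S x).
split; [by exists (fun S => a (i |: S)) | by exists a |] => x.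
rewrite va (bigID (fun S : {set 'I_n} => i \in S)) /= addrC; congr (_ + _).
  by apply: eq_bigl => S; rewrite subsetD1 -!andbA; congr (_ && _); rewrite andbC.
rewrite mulr_sumr (reindex_onto (fun S => i |: S) (fun S => S :\ i)) /=; last first.
  by move=> S /andP[_ iS]; rewrite finset.setD1K.
under [RHS]eq_bigl => S do rewrite subsetD1 -andbA.
under eq_bigl => S.
  rewrite finset.setU11 andbT finset.subUset finset.sub1set iU /=.
  have -> : ((i |: S) :\ i == S) = (i \notin S).
    apply/eqP/idP => [<-|iS]; first by rewrite !inE eqxx.
    by rewrite finset.setU1K.
  over.
rewrite /= (eq_bigl (fun S : {set 'I_n} =>
  (S \subset U) && (i \notin S) && (#|S| <= d)%N)); last first.
  move=> S; case: (boolP (i \in S)) => iS /=; rewrite ?andbF //.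
  by rewrite cardsU1 iS /= andbT andbT.
apply: eq_big => [S|S /andP[/andP[_ iS] _]]; first by rewrite -andbA.
by rewrite chi_setU1 // chi_set1 mulrCA.
Qed.

Lemma sum_pos_eq0 v : (forall x, 0 <= v x) -> \sum_x v x = 0 -> forall x, v x = 0.
Proof.
move=> v0 /eqP; rewrite psumr_eq0 // => /allP h x.
by apply/eqP/(h x); rewrite mem_index_enum.
Qed.

(** Induction on [#|U|] with [v = h + chi [set i] * g]. Neither [g] nor [h] depends on coordinate
    [i], so the odd powers of [chi [set i]] sum to zero; the fourth moment is that of [h], plus that
    of [g], plus six times a cross term. *)
Lemma bonami d U v : lowdeg d U v ->
  2 ^+ n * \sum_x v x ^+ 4 <= 9 ^+ d * (\sum_x v x ^+ 2) ^+ 2.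
Proof.
(* Every base case is a constant function, for which the factor 1 already suffices. *)
have cst d' (w : bits n -> R) : (forall x y, w x = w y) ->
    2 ^+ n * \sum_x w x ^+ 4 <= 9 ^+ d' * (\sum_x w x ^+ 2) ^+ 2.
  move=> wc; pose c := w [ffun=> false].
  under eq_bigr do rewrite (wc _ [ffun=> false]).
  under [in leRHS]eq_bigr do rewrite (wc _ [ffun=> false]).
  rewrite -/c !sumr_const -(mulr_natl (c ^+ 4)) -(mulr_natl (c ^+ 2)) card_bits.
  rewrite (_ : 2 ^+ n * (2 ^+ n * c ^+ 4) = (2 ^+ n * c ^+ 2) ^+ 2); last by ring.
  by rewrite ler_peMl ?sqr_ge0 // exprn_ege1 // ler1n.
elim: {U}#|U| {-2}U (leqnn #|U|) d v => [|m IH] U Um d v vU.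
  move: Um vU; rewrite leqn0 cards_eq0 => /eqP-> /lowdeg0; exact: cst.
case: (eqVneq U finset.set0) => [U0|/finset.set0Pn[i iU]].
  by move: vU; rewrite U0 => /lowdeg0; exact: cst.
case: d vU => [/lowdeg_deg0|d vU]; first exact: cst.
have [g [h [gU hU vE]]] := lowdeg_split vU iU.
have Uim : (#|U :\ i| <= m)%N by move: Um; rewrite (cardsD1 i U) iU.
have {}IHg := IH _ Uim _ _ gU; have {}IHh := IH _ Uim _ _ hU.
have iUi : i \notin U :\ i by rewrite !inE eqxx.
have gf x := lowdeg_flip x gU iUi; have hf x := lowdeg_flip x hU iUi.
have cf x : chi [set i] (flip i x) = - chi [set i] x by rewrite chi_flip inE eqxx.
have odd0 (K : bits n -> R) : (forall x, K (flip i x) = K x) ->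
    \sum_x chi [set i] x * K x = 0.
  by move=> Kf; apply: (@sum_odd i) => x; rewrite cf Kf mulNr.
set G := \sum_x g x ^+ 2; set H := \sum_x h x ^+ 2.
have E2 : \sum_x v x ^+ 2 = H + G.
  transitivity (H + G + \sum_x chi [set i] x * (2 * (h x * g x))); last first.
    by rewrite odd0 ?addr0 // => x; rewrite hf gf.
  rewrite /H /G -!big_split /=. apply: eq_bigr => x _; rewrite vE.
  have := chi_sqr [set i] x; set c := chi _ x => c2.
  rewrite sqrrD exprMn (expr2 c) c2; ring.
have E4 : \sum_x v x ^+ 4 = \sum_x h x ^+ 4 + 6 * (\sum_x h x ^+ 2 * g x ^+ 2)
    + \sum_x g x ^+ 4.
  transitivity (\sum_x h x ^+ 4 + 6 * (\sum_x h x ^+ 2 * g x ^+ 2)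
      + \sum_x g x ^+ 4
      + \sum_x chi [set i] x * (4 * (h x ^+ 3 * g x + h x * g x ^+ 3))); last first.
    by rewrite odd0 ?addr0 // => x; rewrite hf gf.
  rewrite mulr_sumr -!big_split /=; apply: eq_bigr => x _; rewrite vE.
  have := chi_sqr [set i] x; set c := chi _ x => c2.
  rewrite (_ : (h x + c * g x) ^+ 4 = h x ^+ 4 + 6 * (h x ^+ 2 * (c * c * g x ^+ 2))
    + (c * c) * (c * c) * g x ^+ 4
    + c * (4 * (h x ^+ 3 * g x + c * c * (h x * g x ^+ 3)))); last by ring.
  by rewrite c2 !mul1r.
have G0 : 0 <= G by apply: sumr_ge0 => x _; exact: sqr_ge0.
have H0 : 0 <= H by apply: sumr_ge0 => x _; exact: sqr_ge0.
(* [3 * 9 ^+ d] is the geometric mean of the induction constants [9 ^+ d.+1] of [h] and [9 ^+ d] of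
   [g]; six times it is exactly the mixed coefficient in [9 ^+ d.+1 * (H + G) ^+ 2]. *)
have cross : 2 ^+ n * \sum_x h x ^+ 2 * g x ^+ 2 <= 3 * 9 ^+ d * (H * G).
  (* The weights used below divide by [G] and [H]. *)
  case: (eqVneq G 0) => [Gz|Gn0].
    rewrite big1 => [|x _]; first by rewrite mulr0 Gz mulr0 mulr0.
    by rewrite (sum_pos_eq0 _ Gz) ?mulr0 // => y; exact: sqr_ge0.
  case: (eqVneq H 0) => [Hz|Hn0].
    rewrite big1 => [|x _]; first by rewrite mulr0 Hz mul0r mulr0.
    by rewrite (sum_pos_eq0 _ Hz) ?mul0r // => y; exact: sqr_ge0.
  have Gp : 0 < G by rewrite lt_def Gn0.
  have Hp : 0 < H by rewrite lt_def Hn0.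
  (* AM-GM with the weights that balance the two induction hypotheses *)
  have amgm x : h x ^+ 2 * g x ^+ 2 <=
      (G / (6 * H)) * h x ^+ 4 + (3 * H / (2 * G)) * g x ^+ 4.
    rewrite -subr_ge0.
    rewrite (_ : _ - _ = (h x ^+ 2 * G - 3 * H * g x ^+ 2) ^+ 2 / (6 * H * G));
      last by field; rewrite Gn0 Hn0.
    by rewrite divr_ge0 ?sqr_ge0 // ?mulr_ge0 // ltW.
  have : 2 ^+ n * \sum_x h x ^+ 2 * g x ^+ 2 <=
      (G / (6 * H)) * (2 ^+ n * \sum_x h x ^+ 4)
      + (3 * H / (2 * G)) * (2 ^+ n * \sum_x g x ^+ 4).
    move: (G / _) (3 * H / _) amgm => a b amgm.
    rewrite mulrCA [in X in _ + X]mulrCA -mulrDr ler_pM2l ?exprn_gt0 //.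
    by rewrite !mulr_sumr -big_split /=; apply: ler_sum => x _; exact: amgm.
  move=> /le_trans; apply.
  have a1 : 0 <= G / (6 * H) by rewrite divr_ge0 // mulr_ge0.
  have a2 : 0 <= 3 * H / (2 * G) by rewrite divr_ge0 // mulr_ge0.
  apply: le_trans (lerD (ler_wpM2l a1 IHh) (ler_wpM2l a2 IHg)) _.
  rewrite -/G -/H exprS le_eqVlt; apply/orP; left; apply/eqP.
  by field; rewrite Gn0 Hn0.
have D0 : 0 <= 9 ^+ d * G ^+ 2 by rewrite mulr_ge0 ?exprn_ge0.
rewrite E2 E4 !mulrDr (mulrCA _ 6).
rewrite (_ : 9 ^+ d.+1 * (H + G) ^+ 2 = 9 ^+ d.+1 * H ^+ 2 + 6 * (3 * 9 ^+ d * (H * G))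
  + 9 * (9 ^+ d * G ^+ 2)); last by rewrite (exprS 9); ring.
apply: lerD; first apply: lerD => //; first by rewrite ler_pM2l.
by apply: le_trans IHg _; rewrite ler_peMl // ler1n.
Qed.

(** By nonnegativity [\sum_x v x] is a 1-norm, so Hoelder bounds the second moment by the first and
    the fourth. Bonami in degree 2 bounds the fourth by the second, and cancelling the square of the
    second moment leaves the claim. *)
Lemma lowdeg2_sum_sqr v : (forall x, 0 <= v x) -> lowdeg 2 [set: 'I_n] v ->
  2 ^+ n * \sum_x v x ^+ 2 <= 81 * (\sum_x v x) ^+ 2.
Proof.
move=> v0 /bonami; set Q := \sum_x v x ^+ 2; set P := \sum_x v x => B.
have N0 : 0 < 2 ^+ n :> R by rewrite exprn_gt0.
have P0 : 0 <= P by apply: sumr_ge0.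
have Q0 : 0 <= Q by apply: sumr_ge0 => x _; exact: sqr_ge0.
case: (eqVneq P 0) => [Pz|Pn0].
  rewrite /Q big1 => [|x _]; first by rewrite mulr0 Pz expr0n mulr0.
  by rewrite (sum_pos_eq0 _ Pz) ?expr0n.
have Pp : 0 < P by rewrite lt_def Pn0.
case: (eqVneq Q 0) => [->|Qn0]; first by rewrite mulr0 mulr_ge0 ?sqr_ge0.
have Qp : 0 < Q by rewrite lt_def Qn0.
(* [t^2 <= 2/3 s t + 1/3 t^4/s^2] for [t, s >= 0], with [s = Q / P] *)
have pt x : v x ^+ 2 <= 2 / 3 * (Q / P) * v x + P ^+ 2 / (3 * Q ^+ 2) * v x ^+ 4.
  rewrite -subr_ge0; set t := v x; have t0 : 0 <= t := v0 x.
  rewrite (_ : _ - _ = t * (P * t - Q) ^+ 2 * (P * t + 2 * Q) / (3 * P * Q ^+ 2)); last first.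
    by field; rewrite Pn0 Qn0.
  apply: divr_ge0; last by apply: mulr_ge0; rewrite ?sqr_ge0 // mulr_ge0.
  apply: mulr_ge0; first by apply: mulr_ge0; rewrite ?sqr_ge0.
  by apply: addr_ge0; apply: mulr_ge0.
(* Summed over [x], the linear term becomes [2 / 3 * Q] and is absorbed on the left; what remains is
   Hoelder's inequality. *)
have : Q <= 2 / 3 * (Q / P) * P + P ^+ 2 / (3 * Q ^+ 2) * \sum_x v x ^+ 4.
  move: (2 / 3 * (Q / P)) (P ^+ 2 / _) pt => a b pt.
  by rewrite {1}/Q !mulr_sumr -big_split /=; apply: ler_sum => x _; exact: pt.
rewrite -mulrA mulfVK // => h.
have : Q ^+ 3 <= P ^+ 2 * \sum_x v x ^+ 4.
  have : 1 / 3 * Q <= P ^+ 2 / (3 * Q ^+ 2) * \sum_x v x ^+ 4 by lra.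
  rewrite -(ler_pM2r (_ : 0 < 3 * Q ^+ 2)); last by rewrite mulr_gt0 ?exprn_gt0.
  rewrite (_ : 1 / 3 * Q * (3 * Q ^+ 2) = Q ^+ 3); last by field.
  by rewrite (_ : P ^+ 2 / (3 * Q ^+ 2) * _ * _ = P ^+ 2 * \sum_x v x ^+ 4) //; field.
move=> h3.
have : 2 ^+ n * Q ^+ 3 <= P ^+ 2 * (9 ^+ 2 * Q ^+ 2).
  apply: le_trans (ler_wpM2l (ltW N0) h3) _.
  by rewrite mulrCA ler_wpM2l ?sqr_ge0.
move=> h4; rewrite -(ler_pM2r (exprn_gt0 2 Qp)).
rewrite (_ : 2 ^+ n * Q * Q ^+ 2 = 2 ^+ n * Q ^+ 3); last by ring.
by apply: le_trans h4 _; rewrite (_ : _ * (9 ^+ 2 * _) = 81 * P ^+ 2 * Q ^+ 2) //; ring.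
Qed.

Lemma lowdeg2_of_fourier v : (forall S, S \in oblivious_sets n -> fourier v S = 0) ->
  lowdeg 2 [set: 'I_n] v.
Proof.
move=> v0; exists (fun S => fourier v S / 2 ^+ n) => x.
have N0 : 2 ^+ n != 0 :> R by rewrite expf_neq0.
apply: (mulfI N0); rewrite fourier_inversion mulr_sumr [RHS]big_mkcond /=.
apply: eq_bigr => S _; rewrite finset.subsetT /=.
case: ifPn => S2; first by field.
rewrite v0 ?mulr0 ?mul0r ?mulr0 // inE.
by move: S2; case: #|S| => [|[|[|k]]].
Qed.

(** Parseval reads the second moment as the total Fourier weight, of which level 2 is a part. *)
Lemma level2_weight v : (forall x, 0 <= v x) ->
  (forall S, S \in oblivious_sets n -> fourier v S = 0) ->
  \sum_(e : {set 'I_n} | #|e| == 2%N) fourier v e ^+ 2 <= 81 * (\sum_x v x) ^+ 2.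
Proof.
move=> v0 vF; apply: le_trans (lowdeg2_sum_sqr v0 (lowdeg2_of_fourier vF)).
rewrite -parseval [leRHS](bigID (fun e : {set 'I_n} => #|e| == 2%N)) /=.
by rewrite lerDl sumr_ge0 // => S _; exact: sqr_ge0.
Qed.

End Fourier.

(** * Counting perfect matchings *)

Section Matchings.
Variable n : nat.
Implicit Types (i j k : 'I_n) (e : {set 'I_n}) (E : {set {set 'I_n}}).
Implicit Types (Mt : matching n) (s : {perm 'I_n}).

Lemma matchingP Mt :
  finset.partition (val Mt) [set: 'I_n] /\ forall e, e \in val Mt -> #|e| = 2%N.
Proof.
case: Mt => M /= /andP[pM /forallP h]; split=> // e eM.
by apply/eqP; have := h e; rewrite eM.
Qed.

Lemma matching_eq Mt e e' i :
  e \in val Mt -> e' \in val Mt -> i \in e -> i \in e' -> e = e'.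
Proof.
move=> eM e'M ie ie'; have [/partition_trivIset/finset.trivIsetP tM _] := matchingP Mt.
apply/eqP/negPn/negP => ee'; have := tM _ _ eM e'M ee'.
by rewrite -setI_eq0 => /eqP/finset.setP/(_ i); rewrite !inE ie ie'.
Qed.

Lemma matching_partner Mt i : exists2 j, i != j & [set i; j] \in val Mt.
Proof.
have [pM cM] := matchingP Mt.
have : i \in finset.cover (val Mt) by rewrite (cover_partition pM) inE.
move=> /bigcupP[e eM ie]; have /eqP/cards2P[a [b [ab eE]]] := cM _ eM.
move: eM ie; rewrite eE !inE => eM /orP[] /eqP->; first by exists b.
by exists a; [rewrite eq_sym | rewrite finset.setUC].
Qed.

Lemma relabel_perfect s Mt :
  perfect_matching [set s @: e | e : {set 'I_n} in val Mt].
Proof.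
have [pM cM] := matchingP Mt; apply/andP; split.
  have -> : [set: 'I_n] = s @: [set: 'I_n].
    apply/esym/eqP; rewrite eqEcard finset.subsetT /= card_imset //; exact: perm_inj.
  by rewrite imset_partition //; exact: perm_inj.
apply/forallP => e; apply/implyP => /imsetP[e' e'M ->].
by rewrite card_imset ?cM //; exact: perm_inj.
Qed.

(** Vertex permutations act on perfect matchings. This symmetry gives all the ratios below without a
    formula for the number of matchings. *)
Definition relabel s Mt : matching n :=
  exist (fun M => perfect_matching M) _ (relabel_perfect s Mt).

Lemma mem_relabel s Mt e : (s @: e \in val (relabel s Mt)) = (e \in val Mt).
Proof. by rewrite mem_imset //; apply: imset_inj; exact: perm_inj. Qed.

Lemma relabel_inj s : injective (relabel s).
Proof.
move=> M M' /(congr1 val) MM'; apply/val_inj/finset.setP => e.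
by rewrite -(mem_relabel s M) -(mem_relabel s M') MM'.
Qed.

Definition num_matchings E : nat := #|[set Mt : matching n | E \subset val Mt]|.

Lemma num_matchings_relabel s E E' :
  (forall Mt, E \subset val Mt -> E' \subset val (relabel s Mt)) ->
  (num_matchings E <= num_matchings E')%N.
Proof.
move=> h; rewrite /num_matchings -(card_imset _ (relabel_inj (s := s))).
apply: subset_leq_card; apply/fintype.subsetP => M' /imsetP[M].
by rewrite !inE => /h hM ->.
Qed.

(** The transposition of [j] and [k] fixes [i] and every edge of [E], and sends [[set i; j]] to
    [[set i; k]]. *)
Lemma num_matchings_swap E i j k :
  i \notin finset.cover E -> j \notin finset.cover E -> k \notin finset.cover E ->
  j != i -> k != i ->
  (num_matchings ([set i; j] |: E) <= num_matchings ([set i; k] |: E))%N.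
Proof.
move=> iE jE kE ji ki; apply: (@num_matchings_relabel (tperm j k)) => M.
rewrite !finset.subUset !finset.sub1set => /andP[ijM EM]; apply/andP; split.
  have -> : [set i; k] = tperm j k @: [set i; j].
    by rewrite imsetU1 imset_set1 tpermD // tpermL.
  by rewrite mem_relabel.
apply/fintype.subsetP => e eE.
have -> : e = tperm j k @: e.
  rewrite -[LHS]imset_id; apply: eq_in_imset => a ae.
  have ac : a \in finset.cover E by apply/bigcupP; exists e.
  by rewrite tpermD //; [apply: contraNneq jE | apply: contraNneq kE] => ->.
by rewrite mem_relabel (fintype.subsetP EM).
Qed.

(* The partner of [i] is uniformly distributed over the vertices outside [E]. *)
Lemma num_matchings_extend E i j :
  i \notin finset.cover E -> j \notin finset.cover E -> j != i ->
  ((n - #|finset.cover E|).-1 * num_matchings ([set i; j] |: E))%N = num_matchings E.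
Proof.
move=> iE jE ji; set D := ~: (i |: finset.cover E).
have cD : #|D| = (n - #|finset.cover E|).-1.
  by rewrite cardsCs finset.setCK cardsU1 iE card_ord add1n subnS.
have eqD k : k \in D -> num_matchings ([set i; k] |: E) = num_matchings ([set i; j] |: E).
  rewrite !inE negb_or => /andP[ki kE].
  by apply/eqP; rewrite eqn_leq !num_matchings_swap.
rewrite -cD -sum_nat_const -(eq_bigr _ eqD) /num_matchings.
(* Double counting of the pairs of a vertex [k] in [D] and a matching: each matching containing [E]
   is counted once, at the partner of [i]. *)
under eq_bigr do rewrite -sum1_card big_mkcond /=.
rewrite exchange_big /= -sum1_card [RHS]big_mkcond /=; apply: eq_bigr => M _.
rewrite [in RHS]inE; case: ifPn => EM; last first.
  by rewrite big1 // => k _; rewrite inE finset.subUset (negPf EM) andbF.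
have [k ik ikM] := matching_partner M i.
(* An edge of [E] through [k] would have to be [[set i; k]], so [E] would cover [i]. *)
have kE : k \notin finset.cover E.
  apply: contra iE => /bigcupP[e eE ke]; apply/bigcupP; exists e => //.
  have eM := fintype.subsetP EM _ eE.
  by rewrite (@matching_eq M e [set i; k] k) // !inE eqxx ?orbT.
rewrite (bigD1 k) /=; last by rewrite !inE negb_or eq_sym ik.
rewrite inE finset.subUset finset.sub1set ikM EM /= big1 // => k' /andP[_ k'k].
rewrite inE finset.subUset finset.sub1set EM andbT ifN //.
apply: contra k'k => ik'M.
have /finset.setP/(_ k') := matching_eq ik'M ikM (finset.set21 i k') (finset.set21 i k).
rewrite !inE eqxx orbT => /esym/orP[/eqP k'i|//].
by have := (matchingP M).2 _ ik'M; rewrite k'i finset.setUid cards1.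
Qed.

(** Vertex [2m] is paired with [2m + 1]: the edges are the fibres of halving, and evenness of [n]
    keeps the partner in range. *)
Lemma matching_exists : ~~ odd n -> (0 < #|matching n|)%N.
Proof.
move=> n_even; have half_lt i (b : bool) : (i./2.*2 + b < n)%N.
  have nE : n = (n./2 * 2)%N by rewrite muln2 -{1}(odd_double_half n) (negPf n_even).
  have iE : nat_of_ord i = (odd i + i./2 * 2)%N by rewrite muln2 odd_double_half.
  have := ltn_ord i; rewrite -muln2; move: (n./2) (i./2) nE iE => m h.
  by case: b; case: (odd i) => /=; lia.
pose mate i : 'I_n := Ordinal (half_lt i (~~ odd i)).
have mateE i : mate i = i./2.*2 + ~~ odd i :> nat by [].
have mate_neq i : mate i != i.
  apply/eqP => /(congr1 val) /=; have := odd_double_half i; case: (odd i); lia.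
pose M := preim_partition (fun i : 'I_n => i./2) [set: 'I_n].
have pM : perfect_matching M.
  apply/andP; split; first exact: preim_partitionP.
  apply/forallP => e; apply/implyP => /imsetP[i _ ->].
  have -> : [set y in [set: 'I_n] | i./2 == y./2] = [set i; mate i].
    apply/finset.setP => j; rewrite !inE -!val_eqE /=.
    have := odd_double_half i; have := odd_double_half j.
    by case: (odd i); case: (odd j) => /=; lia.
  by rewrite cards2 (eq_sym i) mate_neq.
by apply/card_gt0P; exists (exist (fun M => perfect_matching M) M pM).
Qed.

Lemma num_matchings_edge e : #|e| = 2%N ->
  (n.-1 * num_matchings [set e])%N = #|matching n|.
Proof.
move=> /eqP/cards2P[i [j [ij ->]]].
have c0 : finset.cover (finset.set0 : {set {set 'I_n}}) = finset.set0.
  by rewrite /finset.cover big_set0.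
have := @num_matchings_extend finset.set0 i j; rewrite c0 !inE cards0 subn0.
rewrite finset.setU0 => -> //; last by rewrite eq_sym.
rewrite /num_matchings -cardsT; congr #|pred_of_set _|.
by apply/finset.setP => M; rewrite !inE finset.sub0set.
Qed.

(** Disjoint edges give equality, by extending [[set e]]; distinct edges that meet lie in no common
    matching. *)
Lemma num_matchings_edge2 e e' : #|e| = 2%N -> #|e'| = 2%N -> e != e' ->
  (n.-2.-1 * num_matchings [set e; e'] <= num_matchings [set e])%N.
Proof.
move=> e2 e'2 ee'.
have ce : finset.cover [set e] = e by rewrite /finset.cover big_set1.
case: (boolP [disjoint e & e']) => [dis|/pred0Pn[i /andP[/= ie ie']]]; last first.
  rewrite [num_matchings [set e; e']](_ : _ = 0%N) ?muln0 //.
  apply/eqP; rewrite cards_eq0 -finset.subset0; apply/fintype.subsetP => M.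
  rewrite !inE finset.subUset !finset.sub1set => /andP[eM e'M].
  by rewrite (matching_eq eM e'M ie ie') eqxx in ee'.
move: e'2 dis ee' => /eqP/cards2P[i [j [ij ->]]]; rewrite disjoint_sym => dis _.
have [ie je] : i \notin e /\ j \notin e.
  by split; rewrite (disjointFr dis) ?finset.set21 ?finset.set22.
have := @num_matchings_extend [set e] i j; rewrite ce e2 subn2 finset.setUC => -> //.
by rewrite eq_sym.
Qed.

End Matchings.

(** * Decoding from a fixed hidden state *)

Section Decoding.
Variables (R : realType) (n : nat).
Implicit Types (v : bits n -> R) (e : {set 'I_n}).

(** After exchanging the sums, every pair of vertices lies in the same fraction [1 / (n - 1)] of the
    matchings, and any other set in none. *)
Lemma sum_matchings_edges (c : {set 'I_n} -> R) :
  n.-1%:R * \sum_(Mt : matching n) \sum_(e in val Mt) c e =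
  #|matching n|%:R * \sum_(e : {set 'I_n} | #|e| == 2%N) c e.
Proof.
under eq_bigr do rewrite big_mkcond /=.
rewrite exchange_big /= [in RHS]big_mkcond !mulr_sumr; apply: eq_bigr => e _.
rewrite -big_mkcond sumr_const -(mulr_natl (c e)) mulrA.
case: ifP => [/eqP/num_matchings_edge <-|/eqP e2].
  rewrite natrM; congr (_ * _%:R * _); apply: eq_card => Mt.
  by rewrite !inE finset.sub1set.
rewrite mulr0 (eq_card0 (A := [pred Mt : matching n | e \in val Mt])) ?mulr0 ?mul0r // => Mt.
rewrite inE; apply/negP => eM; apply: e2; exact: (matchingP Mt).2 eM.
Qed.

(** The indicator of [b == parity x e] is [(1 + (-1) ^+ b * chi e x) / 2]. *)
Lemma parity_class_sum v e b :
  2 * \sum_(x | b == parity x e) v x = \sum_x v x + (-1) ^+ b * fourier v e.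
Proof.
rewrite /fourier [in RHS]mulr_sumr -big_split mulr_sumr big_mkcond /=.
apply: eq_bigr => x _; rewrite /chi mulrA -signr_addb.
by case: b; case: (parity x e) => /=; rewrite ?expr0 ?expr1; ring.
Qed.

(** At a fixed hidden state, [v x] is the density of input [x] and [xi] the response. Answering on
    edge [e] wins weight at most [(V + |c e|) / 2], and AM-GM replaces [|c e|] by an expression
    whose average over matchings is controlled by the level-2 weight. *)
Lemma decoding_bound v (xi : forall Mt : matching n, edge Mt * bool -> R) :
  (1 < n)%N -> (forall x, 0 <= v x) ->
  (forall S, S \in oblivious_sets n -> fourier v S = 0) ->
  (forall Mt o, 0 <= xi Mt o) -> (forall Mt, \sum_o xi Mt o <= 1) ->
  \sum_x \sum_(Mt : matching n)
    (\sum_(o : edge Mt * bool | o.2 == parity x (val o.1)) xi Mt o) * v x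
    <= #|matching n|%:R * (1 / 2 + 9 / Num.sqrt (n%:R - 1)) * \sum_x v x.
Proof.
move=> n1 v0 vF xi0 xi1; set V := \sum_x v x; set s := Num.sqrt _.
have V0 : 0 <= V by apply: sumr_ge0.
have n10 : 0 < n%:R - 1 :> R by rewrite subr_gt0 ltr1n.
have s0 : 0 < s by rewrite sqrtr_gt0.
have s2 : s ^+ 2 = n.-1%:R by rewrite sqr_sqrtr ?ltW // -[in LHS](prednK (ltnW n1)) -natr1 addrK.
have [Vz|Vn0] := eqVneq V 0.
  rewrite Vz mulr0 big1 // => x _; rewrite big1 // => Mt _.
  by rewrite (sum_pos_eq0 v0 Vz) mulr0.
have Vp : 0 < V by rewrite lt_def Vn0.
pose c e := fourier v e.
(* This bound is affine in the squared coefficients, unlike the largest [|c e|] in [Mt], so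
   averaging it over matchings only requires the frequency of each edge. *)
pose B (Mt : matching n) := (1 / 2 + 9 / (4 * s)) * V + s / (36 * V) * \sum_(e in val Mt) c e ^+ 2.
have sq0 (Mt : matching n) : 0 <= \sum_(e in val Mt) c e ^+ 2.
  by apply: sumr_ge0 => e _; exact: sqr_ge0.
have sV : 0 <= s / (36 * V) by rewrite divr_ge0 ?mulr_ge0 // ltW.
have B0 Mt : 0 <= B Mt.
  rewrite addr_ge0 // mulr_ge0 // addr_ge0 // divr_ge0 //.
  by rewrite mulr_ge0 // ltW.
have le_B Mt (o : edge Mt * bool) : \sum_(x | o.2 == parity x (val o.1)) v x <= B Mt.
  have oM : val o.1 \in val Mt := valP o.1.
  rewrite -(ler_pM2l (ltr0Sn R 1)) parity_class_sum -/V -/(c _).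
  have : (-1) ^+ o.2 * c (val o.1) <= `|c (val o.1)|.
    by apply: le_trans (ler_norm _) _; rewrite normrM normrX normrN1 expr1n mul1r.
  set a := c _ => h.
  have aM : a ^+ 2 <= \sum_(e in val Mt) c e ^+ 2.
    rewrite (bigD1 (val o.1)) //= lerDl sumr_ge0 // => e _; exact: sqr_ge0.
  (* AM-GM, with the weight that balances the two terms once averaged over matchings *)
  have : `|a| <= 9 / (2 * s) * V + s / (18 * V) * a ^+ 2.
    rewrite -(real_normK (num_real a)) -subr_ge0.
    rewrite (_ : _ - _ = (`|a| * s - 9 * V) ^+ 2 / (18 * s * V)).
      by rewrite divr_ge0 ?sqr_ge0 // !mulr_ge0 // ltW.
    by field; rewrite Vn0 gt_eqF.
  have : s / (18 * V) * a ^+ 2 <= s / (18 * V) * \sum_(e in val Mt) c e ^+ 2.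
    by rewrite ler_wpM2l // divr_ge0 ?mulr_ge0 // ltW.
  rewrite /B; set Q := \sum_(e in _) _.
  have -> : 2%:R * ((1 / 2 + 9 / (4 * s)) * V + s / (36 * V) * Q)
     = V + 9 / (2 * s) * V + s / (18 * V) * Q by field; rewrite Vn0 gt_eqF.
  by lra.
have le_M Mt : \sum_x (\sum_(o : edge Mt * bool | o.2 == parity x (val o.1)) xi Mt o) * v x <= B Mt.
  under eq_bigr => x _ do rewrite big_mkcond mulr_suml.
  rewrite exchange_big /=; apply: (@le_trans _ _ (\sum_o xi Mt o * B Mt)).
    apply: ler_sum => o _; have h := ler_wpM2l (xi0 Mt o) (le_B Mt o); apply: le_trans h.
    rewrite mulr_sumr [leRHS]big_mkcond; apply: ler_sum => x _.
    by case: ifP; rewrite ?mul0r.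
  by rewrite -mulr_suml ler_piMl.
rewrite exchange_big /=; apply: (@le_trans _ _ (\sum_Mt B Mt)).
  by apply: ler_sum => Mt _; exact: le_M.
rewrite big_split /= sumr_const -[_ *+ _]mulr_natl -mulr_sumr.
have H := sum_matchings_edges (fun e => c e ^+ 2).
have W := level2_weight v0 vF; rewrite -/V in W.
rewrite -s2 in H; move: H W; set Q := \sum_Mt _; set P := \sum_(e | _) _; set M := #|_|%:R => H W.
have QE : Q = M * P / s ^+ 2 by rewrite -H mulrAC divff ?mul1r // sqrf_eq0 gt_eqF.
have M0 : 0 <= M by rewrite ler0n.
apply: (@le_trans _ _ (M * ((1 / 2 + 9 / (4 * s)) * V)
  + s / (36 * V) * (M * (81 * V ^+ 2) / s ^+ 2))).
  rewrite lerD2l ler_wpM2l // QE ler_wpM2r ?invr_ge0 ?sqr_ge0 //.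
  by rewrite ler_wpM2l.
(* Both error terms are now [9 / (4 * s)] times [M * V]; half of the allowed [9 / s] is left
   over. *)
rewrite -subr_ge0.
rewrite (_ : _ - _ = 9 / 2 * (M * V) / s); last by field; rewrite Vn0 gt_eqF.
by rewrite divr_ge0 ?mulr_ge0 // ltW.
Qed.

End Decoding.

(** * Densities of the state measures *)

Section Measure.
Local Open Scope ereal_scope.
Context (d : measure_display) (T : measurableType d) (R : realType).

(** Radon-Nikodym: positive weights make [nu] dominate every [mu i]. Linear relations between the
    measures become relations between the densities that hold almost everywhere. *)
Lemma densities (I : finType) (w : I -> R) (mu : I -> probability T R)
    (nu : probability T R) :
  (forall i, 0 < w i)%R ->
  (forall A, measurable A -> nu A = \sum_i (w i)%:E * mu i A) ->
  exists rho : I -> T -> R, [/\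
    forall i, measurable_fun [set: T]%classic (rho i),
    forall i t, (0 <= rho i t)%R,
    forall i (f : T -> R), measurable_fun [set: T]%classic f -> (forall t, 0 <= f t)%R ->
      \int[mu i]_(t in [set: T]%classic) (f t)%:E =
      \int[nu]_(t in [set: T]%classic) (f t * rho i t)%:E &
    forall a : I -> R,
      (forall A, measurable A -> \sum_i (a i * fine (mu i A))%R = 0%R)%R ->
      {ae nu, forall t, (\sum_i a i * rho i t)%R = 0%R}].
Proof.
move=> w0 nuE.
(* On a [nu]-null set the nonnegative terms [w j * mu j A] sum to zero, so each of them vanishes. *)
have dom i : mu i `<< nu.
  apply/null_content_dominatesP => A mA nuA0.
  have h : \sum_j (w j)%:E * mu j A = 0 by rewrite -nuE.
  have : (w i)%:E * mu i A <= 0.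
    rewrite -h (bigD1 i) //= leeDl // sume_ge0 // => j _.
    by rewrite mule_ge0 // lee_fin ltW.
  rewrite pmule_rle0 ?lte_fin // => h'.
  by apply/eqP; rewrite eq_le h' measure_ge0.
pose f i := Radon_Nikodym_SigmaFinite.f (mu i) nu.
have fE i t : f i t = (fine (f i t))%:E.
  by rewrite fineK // Radon_Nikodym_SigmaFinite.f_fin_num //; exact: dom.
have f_int i : nu.-integrable [set: T]%classic (f i).
  by apply: Radon_Nikodym_SigmaFinite.f_integrable; exact: dom.
exists (fun i t => fine (f i t)); split.
- move=> i; apply/measurable_EFinP.
  apply: (eq_measurable_fun (f i)); first by move=> t _; rewrite [LHS]fE.
  exact: measurable_int (f_int i).
- by move=> i t; rewrite fine_ge0 // Radon_Nikodym_SigmaFinite.f_ge0 //; exact: dom.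
- move=> i g mg g0.
  have := Radon_Nikodym_SigmaFinite.change_of_variables (dom i) (f := EFin \o g)
    (E := [set: T]%classic).
  move=> <- //; last exact/measurable_EFinP.
  by apply: eq_integral => t _; rewrite -/(f i) fE EFinM.
move=> a a0.
(* The combination of densities integrates to zero over every measurable set, hence vanishes almost
   everywhere. *)
have h : ae_eq nu [set: T]%classic (fun t => \sum_i (a i)%:E * f i t) (cst 0).
  apply: integral_ae_eq => //.
    by apply: integrable_sum => // i _; exact: integrableZl.
  move=> A _ mA; rewrite integral_sum //; last first.
    by move=> i; apply: integrableZl => //; apply: integrableS (f_int i).
  rewrite integral0 -[RHS](congr1 EFin (a0 _ mA)) -sumEFin.
  apply: eq_bigr => i _; rewrite integralZl //; last exact: integrableS (f_int i).
  rewrite -Radon_Nikodym_SigmaFinite.f_integral //; last exact: dom.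
  by rewrite EFinM fineK // fin_num_measure.
move: h; apply: filterS => t /= /(_ Logic.I) h.
apply: EFin_inj; rewrite -sumEFin -[RHS]h; apply: eq_bigr => i _.
by rewrite EFinM -fE.
Qed.

End Measure.

Lemma fsbig_finType (R : realType) (I : finType) (a : I -> \bar R) :
  (\sum_(i \in [set: I]%classic) a i = \sum_i a i)%E.
Proof.
rewrite [RHS](fsbig_seq _ _ (index_enum_uniq I)); apply: eq_fsbigl.
by apply/seteqP; split=> i //= _; rewrite mem_index_enum.
Qed.

Lemma esum_finType (R : realType) (I : finType) (a : I -> \bar R) :
  (forall i, 0 <= a i)%E -> (\esum_(i in [set: I]%classic) a i = \sum_i a i)%E.
Proof. by move=> a0; rewrite esum_fset ?fsbig_finType //; exact: finite_finset. Qed.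

(** * The upper bound in noncontextual theories *)

Section UpperBound.
Variables (R : realType) (n : nat).

(** [chi R S] is the difference of the indicators of the two parity classes, which have equal size.
    This translates obliviousness into vanishing Fourier coefficients for the upper bound, and back
    for the clique protocol. *)
Lemma chi_sum_parity_class (m : bits n -> R) S (hS : S \in oblivious_sets n) :
  \sum_x chi R S x * m x = 0 <->
  \sum_x uniform_on R (parity_class_neq0 false hS) x * m x =
  \sum_x uniform_on R (parity_class_neq0 true hS) x * m x.
Proof.
have SN0 : (S == finset.set0) = false by move: hS; rewrite inE cards_eq0 => /andP[/negPf].
have split_chi x : chi R S x =
    (x \in parity_class S false)%:R - (x \in parity_class S true)%:R.
  by rewrite !inE /chi; case: (parity x S); rewrite ?expr0 ?expr1 ?subr0 ?sub0r.
have count b : \sum_x (x \in parity_class S b)%:R = #|parity_class S b|%:R :> R.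
  by rewrite -natr_sum -big_mkcond sum1_card.
have eqc : #|parity_class S false|%:R = #|parity_class S true|%:R :> R.
  apply/eqP; rewrite -subr_eq0 -!count -sumrB -(eq_bigr _ (fun x _ => split_chi x)).
  by rewrite sum_chi SN0.
have c0 : #|parity_class S true|%:R != 0 :> R.
  by rewrite pnatr_eq0 cards_eq0 parity_class_neq0.
have -> : \sum_x chi R S x * m x = #|parity_class S true|%:R *
   (\sum_x uniform_on R (parity_class_neq0 false hS) x * m x -
    \sum_x uniform_on R (parity_class_neq0 true hS) x * m x).
  rewrite -sumrB mulr_sumr; apply: eq_bigr => x _.
  by rewrite /= /uniform_weight split_chi eqc; field.
by split=> [/eqP|->]; rewrite ?subrr ?mulr0 // mulf_eq0 (negPf c0) subr_eq0 => /eqP.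
Qed.

Variable T : op_theory R.

(** For almost every hidden state [t], the densities [rho x t] as a function of [x] meet the
    hypotheses of [decoding_bound]; integrating that bound over [nu] gives the claim. *)
Lemma nc_success_bound (pr : hm_protocol T n) : (1 < n)%N ->
  admits_nc_model T -> parity_oblivious pr ->
  p_succ pr <= 1 / 2 + 9 / Num.sqrt (n%:R - 1).
Proof.
move=> n1 [mdl nc] po.
have setT_neq0 : [set: bits n] != finset.set0.
  by apply/finset.set0Pn; exists [ffun=> false]; rewrite inE.
pose w := uniform_on R setT_neq0.
pose mu x := ont_mu mdl (hm_prep pr x).
pose nu := ont_mu mdl (mix w (hm_prep pr)).
have w0 x : 0 < w x.
  rewrite /= /uniform_weight inE div1r invr_gt0 ltr0n cardsT.
  by apply/card_gt0P; exists [ffun=> false].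
have [rho [rho_meas rho0 rho_int rho_ae]] := densities w0 (ont_mu_mix (o := mdl) w (hm_prep pr)).
(* Obliviousness makes the two parity mixtures operationally equivalent, noncontextuality equates
   their measures, and [ont_mu_mix] expands both over [x]. *)
have fourier_mu S : S \in oblivious_sets n -> forall A, measurable A ->
    \sum_x chi R S x * fine (mu x A) = 0.
  move=> hS A mA; apply/(chi_sum_parity_class _ hS).
  have := nc _ _ (po S hS) A mA; rewrite !ont_mu_mix //.
  have mE b : (\sum_x (uniform_on R (parity_class_neq0 b hS) x)%:E * ont_mu mdl (hm_prep pr x) A
     = (\sum_x uniform_on R (parity_class_neq0 b hS) x * fine (mu x A))%:E)%E.
    by rewrite -sumEFin; apply: eq_bigr => x _; rewrite [RHS]EFinM fineK // fin_num_measure.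
  by rewrite !mE => -[].
have rho_fourier : {ae nu, forall t, forall S, S \in oblivious_sets n ->
    fourier (fun x => rho x t) S = 0}.
  (* The exceptional null set depends on [S]; there are finitely many [S], so a common one
     exists. *)
  have : forall S, {ae nu, forall t, S \in oblivious_sets n ->
      fourier (fun x => rho x t) S = 0}.
    move=> S; case: (boolP (S \in oblivious_sets n)) => [hS|_]; last exact: aeW.
    by have := rho_ae _ (fourier_mu S hS); apply: filterS.
  exact: filter_forall.
pose xi Mt (o : edge Mt * bool) t := ont_xi (o := mdl) (hm_out pr o) t.
pose g x t := \sum_(Mt : matching n)
  \sum_(o : edge Mt * bool | o.2 == parity x (val o.1)) xi Mt o t.
have xi0 Mt o t : 0 <= xi Mt o t by case/andP: (ont_xi_itv (o := mdl) (hm_out pr (Mt := Mt) o) t).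
have xi_meas Mt o : measurable_fun [set: ont_space mdl]%classic (xi Mt o).
  exact: ont_xi_measurable.
have xi_sum Mt t : \sum_o xi Mt o t <= 1.
  rewrite -lee_fin -(ont_xi_sum1 (o := mdl) (hm_meas pr Mt) t) -sumEFin.
  (* Since [hm_out] is injective, the sum over [o] is a finite partial sum of the unordered sum over
     all outcomes. *)
  apply: esum_ge; exists (range (@hm_out _ _ _ pr Mt)).
    by split => //; apply: finite_image; exact: finite_finset.
  rewrite fsbig_image ?fsbig_finType //.
  by move=> o o' _ _; exact: (bij_inj (hm_out_bij pr Mt)).
have g_meas x : measurable_fun [set: ont_space mdl]%classic (g x).
  apply: measurable_sum => Mt; apply: (eq_measurable_fun (fun t =>
    \sum_(o : edge Mt * bool) if o.2 == parity x (val o.1) then xi Mt o t else 0)).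
    by move=> t _; rewrite -big_mkcond.
  by apply: measurable_sum => o; case: (o.2 == parity x (val o.1)).
have g0 x t : 0 <= g x t by apply: sumr_ge0 => Mt _; apply: sumr_ge0 => o _.
have prob_g x : ((\sum_(Mt : matching n) \sum_(o : edge Mt * bool | o.2 == parity x (val o.1))
      prob T (hm_prep pr x) (hm_out pr o))%:E =
    \int[mu x]_(t in [set: ont_space mdl]%classic) (g x t)%:E)%E.
  have xi_int Mt o : (mu x).-integrable [set: ont_space mdl]%classic (EFin \o xi Mt o).
    apply: measurable_bounded_integrable => //; first by rewrite ltey_eq fin_num_measure.
    exists 1; split; first exact: num_real.
    move=> M M1 t _; apply: le_trans (ltW M1).
    by have /andP[xi0' xi1'] := ont_xi_itv (o := mdl) (hm_out pr (Mt := Mt) o) t; rewrite ger0_norm.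
  under eq_integral => t _ do rewrite -sumEFin.
  rewrite integral_sum //=; last first.
    move=> Mt; under eq_fun do rewrite -sumEFin.
    by apply: integrable_sum => // o _; exact: xi_int.
  rewrite -sumEFin; apply: eq_bigr => Mt _.
  under eq_integral => t _ do rewrite -sumEFin.
  rewrite integral_sum //=; last by move=> o; exact: xi_int.
  by rewrite -sumEFin; apply: eq_bigr => o _; exact: ont_prob.
set b := 1 / 2 + _; have b0 : 0 <= b.
  by rewrite addr_ge0 ?divr_ge0 // sqrtr_ge0.
pose N : R := #|matching n|%:R.
have rho1 x : (\int[nu]_(t in [set: ont_space mdl]%classic) (rho x t)%:E = 1)%E.
  have := rho_int x (cst 1) (measurable_cst _) (fun=> ler01).
  under [in RHS]eq_integral do rewrite mul1r.
  move=> <-; transitivity (1 * mu x [set: ont_space mdl]%classic)%E.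
    exact: (integral_cst _ _ 1%E).
  by rewrite mul1e; exact: probability_setT.
have total : (\sum_x \int[nu]_(t in [set: ont_space mdl]%classic) (g x t * rho x t)%:E <=
    (N * b * 2 ^+ n)%:E)%E.
  rewrite -ge0_integral_sum //; last 2 first.
  - by move=> x; apply/measurable_EFinP; exact: measurable_funM.
  - by move=> x t _; rewrite lee_fin mulr_ge0.
  apply: (@le_trans _ _ (\int[nu]_(t in [set: ont_space mdl]%classic)
      ((N * b)%:E * \sum_x (rho x t)%:E))%E).
    apply: ae_ge0_le_integral => //.
    - by move=> t _; apply: sume_ge0 => x _; rewrite lee_fin mulr_ge0.
    - by apply: emeasurable_sum => x; apply/measurable_EFinP; exact: measurable_funM.
    - move=> t _; rewrite mule_ge0 ?lee_fin ?mulr_ge0 //.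
      by apply: sume_ge0 => x _; rewrite lee_fin.
    - apply: emeasurable_funM => //; apply: emeasurable_sum => x.
      exact/measurable_EFinP.
    move: rho_fourier; apply: filterS => t ft _.
    rewrite !sumEFin -EFinM lee_fin.
    have := decoding_bound n1 (fun x => rho0 x t) ft (fun Mt o => xi0 Mt o t)
      (fun Mt => xi_sum Mt t).
    by apply: le_trans; apply: ler_sum => x _; rewrite mulr_suml.
  rewrite ge0_integralZl //; last 3 first.
  - by apply: emeasurable_sum => x; apply/measurable_EFinP.
  - by move=> t _; apply: sume_ge0 => x _; rewrite lee_fin.
  - by rewrite lee_fin mulr_ge0.
  rewrite ge0_integral_sum //; last 2 first.
  - by move=> x; apply/measurable_EFinP.
  - by move=> x t _; rewrite lee_fin.
  rewrite (eq_bigr (fun=> 1%:E) (fun x _ => rho1 x)) sumEFin sumr_const card_bits.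
  by rewrite -EFinM.
have N0 : 0 <= N by rewrite ler0n.
rewrite /p_succ -/N card_bits.
set P := \sum_x _; have PE : P <= N * b * 2 ^+ n.
  rewrite -lee_fin; apply: le_trans total; rewrite /P -sumEFin.
  by apply: lee_sum => x _; rewrite prob_g rho_int.
(* With no perfect matching, as for odd [n], the normalising factor is the default inverse of 0, so
   the success probability is 0. *)
have [Nz|Nn0] := eqVneq N 0; first by rewrite Nz mulr0 invr0 mul0r.
rewrite mulrC ler_pdivrMr; first by rewrite mulrCA mulrC -mulrA mulrCA mulrA.
by rewrite mulr_gt0 ?exprn_gt0 // lt_def Nn0.
Qed.

End UpperBound.

(** * Classical theories with a finite state space *)

(** An alias of [L] that carries the power set as sigma-algebra; [l0] makes it pointed and is the
    default element in enumerations. *)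
Definition discrete (L : finType) (l0 : L) : Type := L.

HB.instance Definition _ (L : finType) (l0 : L) := Finite.on (discrete l0).

HB.instance Definition _ (L : finType) (l0 : L) := isPointed.Build (discrete l0) l0.

HB.instance Definition _ (L : finType) (l0 : L) := @isMeasurable.Build
  default_measure_display (discrete l0) discrete_measurable
  discrete_measurable0 discrete_measurableC discrete_measurableU.

Section FiniteTheory.
Variables (R : realType) (L : finType) (l0 : L).

(** Written as an [msum] of scaled Dirac masses, so that its measure structure is inferred. *)
Definition fdist_measure (P : fdist R L) : set (discrete l0) -> \bar R :=
  msum (fun k => mscale (NngNum (weight_ge0 P (nth l0 (enum L) k)))
    (dirac (nth l0 (enum L) k : discrete l0))) #|L|.

HB.instance Definition _ (P : fdist R L) := Measure.on (fdist_measure P).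

Lemma sum_nth_enum (V : nmodType) (F : L -> V) :
  \sum_(k < #|L|) F (nth l0 (enum L) k) = \sum_i F i.
Proof.
rewrite -[RHS]big_enum (big_nth l0) big_mkord /=.
by rewrite -[in RHS]cardE.
Qed.

Lemma fdist_measureE (P : fdist R L) (A : set (discrete l0)) :
  fdist_measure P A = (\sum_l (P l)%:E * \d_(l : discrete l0) A)%E.
Proof.
exact: (sum_nth_enum (fun l => (P l)%:E * \d_(l : discrete l0) A)%E).
Qed.

Lemma fdist_measure_setT (P : fdist R L) :
  fdist_measure P [set: discrete l0]%classic = 1%E.
Proof.
rewrite fdist_measureE -[RHS](congr1 EFin (weight_sum1 P)) -sumEFin.
by apply: eq_bigr => l _; rewrite diracT mule1.
Qed.

HB.instance Definition _ (P : fdist R L) :=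
  Measure_isProbability.Build _ _ _ (fdist_measure P) (fdist_measure_setT P).

Lemma measurable_discrete (f : discrete l0 -> R) :
  measurable_fun [set: discrete l0]%classic f.
Proof. by []. Qed.

Lemma integral_fdist_measure (P : fdist R L) (f : discrete l0 -> R) :
  (forall l, 0 <= f l) ->
  (\int[fdist_measure P]_(l in [set: discrete l0]%classic) (f l)%:E
     = (\sum_l P l * f l)%:E)%E.
Proof.
move=> f0; have mf : measurable_fun [set: discrete l0]%classic (EFin \o f) by [].
rewrite ge0_integral_measure_sum //=; last by move=> l _; rewrite lee_fin.
rewrite -(sum_nth_enum (fun l => (P l * f l)%R)) -sumEFin; apply: eq_bigr => k _.
rewrite ge0_integral_mscale //=; last by move=> l _; rewrite lee_fin.
have -> := integral_dirac (nth l0 (enum L) k : discrete l0) measurableT mf.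
by rewrite diracT mul1e.
Qed.

Definition mix_weight (I : finType) (w : fdist R I) (P : I -> fdist R L) (l : L) : R :=
  \sum_i w i * P i l.

Lemma mix_weight_ge0 (I : finType) (w : fdist R I) (P : I -> fdist R L) l :
  0 <= mix_weight w P l.
Proof. by apply: sumr_ge0 => i _; rewrite mulr_ge0 ?weight_ge0. Qed.

Lemma mix_weight_sum1 (I : finType) (w : fdist R I) (P : I -> fdist R L) :
  \sum_l mix_weight w P l = 1.
Proof.
rewrite exchange_big -[RHS](weight_sum1 w) /=; apply: eq_bigr => i _.
by rewrite -mulr_sumr weight_sum1 mulr1.
Qed.

Definition mix_fdist (I : finType) (w : fdist R I) (P : I -> fdist R L) : fdist R L :=
  FDist (mix_weight_ge0 w P) (mix_weight_sum1 w P).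

(** Measurements are deterministic: each reads off a function of the hidden state. *)
Definition finite_meas : Type := {A : finType & L -> A}.

Definition finite_prob (P : fdist R L) (M : finite_meas) (k : tag M) : R :=
  \sum_l P l * (tagged M l == k)%:R.

Lemma finite_prob_ge0 P M k : 0 <= @finite_prob P M k.
Proof. by apply: sumr_ge0 => l _; rewrite mulr_ge0 ?weight_ge0. Qed.

Lemma finite_prob_sum1 (P : fdist R L) (M : finite_meas) :
  (\esum_(k in [set: tag M]%classic) (finite_prob P k)%:E = 1)%E.
Proof.
rewrite esum_finType => [|k]; last by rewrite lee_fin finite_prob_ge0.
rewrite sumEFin exchange_big /=; congr (_%:E).
rewrite -[RHS](weight_sum1 P); apply: eq_bigr => l _.
rewrite -mulr_sumr (bigD1 (tagged M l)) //= eqxx big1 ?addr0 ?mulr1 // => k.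
by rewrite eq_sym => /negPf->.
Qed.

Lemma finite_prob_mix (I : finType) (w : fdist R I) (P : I -> fdist R L)
    (M : finite_meas) (k : tag M) :
  finite_prob (mix_fdist w P) k = \sum_i w i * finite_prob (P i) k.
Proof.
rewrite /finite_prob; under eq_bigr do rewrite mulr_suml.
rewrite exchange_big /=; apply: eq_bigr => i _; rewrite mulr_sumr.
by apply: eq_bigr => l _; rewrite mulrA.
Qed.

Definition finite_theory : op_theory R :=
  @OpTheory R (fdist R L) finite_meas (fun M => tag M)
    finite_prob finite_prob_ge0 finite_prob_sum1 mix_fdist finite_prob_mix.

Definition finite_xi (M : finite_meas) (k : tag M) (l : discrete l0) : R :=
  (tagged M l == k)%:R.

Lemma finite_xi_itv (M : finite_meas) (k : tag M) l : 0 <= finite_xi k l <= 1.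
Proof. by rewrite /finite_xi ler0n lern1 leq_b1. Qed.

Lemma finite_xi_sum1 (M : finite_meas) l :
  (\esum_(k in [set: tag M]%classic) (finite_xi k l)%:E = 1)%E.
Proof.
rewrite esum_finType => [|k]; last by rewrite lee_fin; case/andP: (finite_xi_itv k l).
rewrite sumEFin (bigD1 (tagged M l)) //= /finite_xi eqxx big1 ?addr0 // => k.
by rewrite eq_sym => /negPf->.
Qed.

Lemma finite_ont_prob (P : fdist R L) (M : finite_meas) (k : tag M) :
  ((finite_prob P k)%:E =
   \int[fdist_measure P]_(l in [set: discrete l0]%classic) (finite_xi k l)%:E)%E.
Proof.
by rewrite integral_fdist_measure // => l; case/andP: (finite_xi_itv k l).
Qed.

Lemma finite_mu_mix (I : finType) (w : fdist R I) (P : I -> fdist R L)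
    (A : set (discrete l0)) : measurable A ->
  (fdist_measure (mix_fdist w P) A = \sum_i (w i)%:E * fdist_measure (P i) A)%E.
Proof.
move=> _; rewrite fdist_measureE.
have dE l : \d_(l : discrete l0) A = (\1_A l)%:E :> \bar R by [].
transitivity (\sum_l mix_weight w P l * \1_A l)%:E.
  by rewrite -sumEFin; apply: eq_bigr => l _; rewrite EFinM.
transitivity (\sum_i w i * \sum_l P i l * \1_A l)%:E; last first.
  rewrite -sumEFin; apply: eq_bigr => i _; rewrite EFinM fdist_measureE -sumEFin.
  by congr (_ * _)%E; apply: eq_bigr => l _; rewrite EFinM.
congr (_%:E); under eq_bigr do rewrite mulr_suml.
rewrite exchange_big /=; apply: eq_bigr => i _; rewrite mulr_sumr.
by apply: eq_bigr => l _; rewrite mulrA.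
Qed.

Definition finite_model : ont_model finite_theory :=
  @OntModel R finite_theory default_measure_display (discrete l0)
    (fun P => fdist_measure P : probability (discrete l0) R)
    finite_xi (fun M k => measurable_discrete (finite_xi k))
    finite_xi_itv finite_xi_sum1 finite_ont_prob finite_mu_mix.

(* The measurement revealing the hidden state separates all preparations. *)
Lemma finite_theory_nc : admits_nc_model finite_theory.
Proof.
exists finite_model => P P' PP' A _ /=; rewrite !fdist_measureE.
apply: eq_bigr => l _; congr (_%:E * _)%E.
have := PP' (existT (fun A : finType => L -> A) L id) l; rewrite /= /finite_prob /=.
have reveal (Q : fdist R L) : \sum_l' Q l' * (l' == l)%:R = Q l.
  by rewrite (bigD1 l) //= eqxx mulr1 big1 ?addr0 // => l' /negPf->; rewrite mulr0.
by rewrite !reveal.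
Qed.

End FiniteTheory.

(** * Matchings meeting a clique *)

Section CliqueHits.
Variables (R : realType) (n : nat) (K : {set 'I_n}).
Implicit Types (Mt : matching n) (e : {set 'I_n}).

Definition pairs_in : {set {set 'I_n}} := [set e : {set 'I_n} | (e \subset K) && (#|e| == 2%N)].

Definition hits Mt := [exists e in pairs_in, e \in val Mt].

Definition num_in Mt : R := \sum_(e in pairs_in) (e \in val Mt)%:R.

Lemma num_matchings1 e :
  \sum_(Mt : matching n) (e \in val Mt)%:R = (num_matchings [set e])%:R :> R.
Proof.
rewrite -natr_sum -big_mkcond sum1_card /=; congr _%:R; apply: eq_card => Mt.
by rewrite !inE finset.sub1set.
Qed.

Lemma num_matchings2 e e' :
  \sum_(Mt : matching n) (e \in val Mt)%:R * (e' \in val Mt)%:R =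
  (num_matchings [set e; e'])%:R :> R.
Proof.
under eq_bigr do rewrite -natrM mulnb.
rewrite -natr_sum -big_mkcond sum1_card /=; congr _%:R; apply: eq_card => Mt.
by rewrite !inE finset.subUset !finset.sub1set.
Qed.

Lemma sum_num_in :
  n.-1%:R * \sum_(Mt : matching n) num_in Mt = #|pairs_in|%:R * #|matching n|%:R.
Proof.
rewrite exchange_big mulr_sumr /=.
under eq_bigr => e do [rewrite inE => /andP[_ /eqP e2];
  rewrite num_matchings1 -natrM num_matchings_edge //].
by rewrite sumr_const mulr_natl.
Qed.

(** Second factorial moment: [num_in Mt * (num_in Mt - 1)] counts ordered pairs of distinct edges of
    [Mt] inside [K], and [num_matchings_edge2] bounds the frequency of each pair. *)
Lemma sum_num_in2 : (3 < n)%N ->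
  n.-2.-1%:R * \sum_(Mt : matching n) num_in Mt * (num_in Mt - 1) <=
  (#|pairs_in|%:R - 1) * \sum_(Mt : matching n) num_in Mt.
Proof.
move=> n3.
have -> : \sum_(Mt : matching n) num_in Mt * (num_in Mt - 1) =
    \sum_(e in pairs_in) \sum_(e' in pairs_in | e' != e) (num_matchings [set e; e'])%:R.
  under [RHS]eq_bigr do under eq_bigr do rewrite -num_matchings2.
  under [RHS]eq_bigr do rewrite exchange_big /=.
  rewrite [RHS]exchange_big /=; apply: eq_bigr => Mt _.
  rewrite {1}/num_in mulr_suml; apply: eq_bigr => e eP; rewrite -mulr_sumr.
  case: (e \in val Mt) / boolP => eM; rewrite ?mul0r // !mul1r.
  by rewrite /num_in (bigD1 e) //= eM addrAC subrr add0r.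
rewrite exchange_big /= !mulr_sumr; apply: ler_sum => e eP.
rewrite num_matchings1 mulr_sumr.
have -> : #|pairs_in|%:R - 1 = \sum_(e' in pairs_in | e' != e) 1 :> R.
  have /(congr1 (fun m => m%:R : R)) := cardsD1 e pairs_in.
  rewrite eP natrD => ->; rewrite addrAC subrr add0r -sum1_card natr_sum.
  by apply: eq_bigl => e'; rewrite !inE andbC.
rewrite mulr_suml; apply: ler_sum => e' /andP[e'P ee'].
rewrite mul1r -natrM ler_nat; move: eP e'P; rewrite !inE => /andP[_ /eqP e2] /andP[_ /eqP e'2].
by apply: num_matchings_edge2 => //; rewrite eq_sym.
Qed.

(** Twice Bonferroni's lower bound: with [m] edges inside [K] the left side is [m (3 - m)], which is
    at most 2 for every natural [m] and is 0 for [m = 0]. *)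
Lemma hits_ge Mt : 2 * num_in Mt - num_in Mt * (num_in Mt - 1) <= 2 * (hits Mt)%:R.
Proof.
have [m mE] : exists m, num_in Mt = m%:R.
  by exists (\sum_(e in pairs_in) (e \in val Mt))%N; rewrite natr_sum.
case: (boolP (hits Mt)) => [_|/exists_inPn h]; last first.
  rewrite /num_in big1 ?mul0r ?mulr0 ?subr0 // => e eP.
  by rewrite (negPf (h _ eP)).
rewrite mE; case: m {mE} => [|[|m]]; rewrite ?mulr0 ?mul0r ?subr0 //.
  by rewrite subrr mulr0 subr0.
rewrite -(natr1 m.+1) -(natr1 m); have := ler0n R m.
have : 0 <= m%:R * (m%:R + 1) :> R by rewrite mulr_ge0 ?addr_ge0.
by rewrite /= => h1 h2; nra.
Qed.

(* Bonferroni; [k ^ 2 <= n] keeps the pair term below half of the main one. *)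
Lemma sum_hits_ge : (3 < n)%N -> (#|K| ^ 2 <= n)%N -> (0 < #|K|)%N ->
  3 * (#|K| * #|K|.-1)%:R * #|matching n|%:R <=
  8 * n.-1%:R * \sum_(Mt : matching n) (hits Mt)%:R :> R.
Proof.
move=> n3 Kn K0.
have cP : #|pairs_in|%:R * 2 = (#|K| * #|K|.-1)%:R :> R.
  by rewrite cards_draws -natrM (bin_ffact _ 2) ffactnS ffactn1.
have H1 := sum_num_in; have H2 := sum_num_in2 n3.
set X := \sum_Mt num_in Mt in H1 H2; set Y := \sum_Mt _ * _ in H2.
set Hs := \sum_Mt (hits Mt)%:R; set P := #|pairs_in|%:R in cP H1 H2.
have XY : 2 * X - Y <= 2 * Hs.
  rewrite /X /Y /Hs !mulr_sumr -sumrB; apply: ler_sum => Mt _; exact: hits_ge.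
have X0 : 0 <= X by apply: sumr_ge0 => Mt _; apply: sumr_ge0.
have n30 : 0 < n.-2.-1%:R :> R by rewrite ltr0n; lia.
have YX : 2 * Y <= X.
  rewrite -(ler_pM2l n30) mulrCA; apply: (@le_trans _ _ ((2 * (P - 1)) * X)).
    by rewrite -mulrA ler_pM2l.
  (* With [k = #|K|] this asks for [k (k - 1) <= n - 1], which follows from [k ^ 2 <= n] and
     [k >= 1]. *)
  apply: ler_wpM2r => //; rewrite mulrBr mulrC cP mulr1 lerBlDr -natrD ler_nat.
  by move: Kn K0 n3; case: #|K| => // k; rewrite expnS expn1 /=; nia.
(* [XY] and [YX] give [3 / 2 * X <= 2 * Hs], that is [6 * X <= 8 * Hs]. *)
rewrite -cP; have -> : 3 * (P * 2) * #|matching n|%:R = 6 * (n.-1%:R * X) by rewrite H1; ring.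
rewrite (mulrC 8) -mulrA mulrCA ler_pM2l; last by rewrite ltr0n; lia.
lra.
Qed.

End CliqueHits.

(** * The clique protocol *)

Section CliqueProtocol.
Variables (R : realType) (n : nat) (K : {set 'I_n}).
Hypothesis K_neq0 : K != finset.set0.
Implicit Types (x y z : bits n) (S e : {set 'I_n}).

(** With [k = #|K|] this is 1 plus [2 / k] times the sum of [chi e] over the pairs [e] inside [K]:
    nonnegative as a square, yet with characters of sizes 0 and 2 only. *)
Definition kernel z : R := (\sum_(i in K) chi R [set i] z) ^+ 2 / #|K|%:R.

Lemma K_card_neq0 : #|K|%:R != 0 :> R.
Proof. by rewrite pnatr_eq0 cards_eq0. Qed.

Lemma kernel_ge0 z : 0 <= kernel z.
Proof. by rewrite divr_ge0 ?sqr_ge0. Qed.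

Lemma symdiff_eq0 S U : (symdiff S U == finset.set0 :> {set 'I_n}) = (S == U).
Proof.
apply/eqP/eqP => [/finset.setP h|->]; last by apply/finset.setP => i; rewrite !inE addbb.
by apply/finset.setP => i; have := h i; rewrite !inE; case: (i \in S); case: (i \in U).
Qed.

(** Expanding the square gives the characters of [symdiff [set i] [set j]]; orthogonality keeps the
    ordered pairs for which this set is [S]. *)
Lemma fourier_kernel S :
  fourier kernel S = 2 ^+ n / #|K|%:R *
    \sum_(i in K) \sum_(j in K) (S == symdiff [set i] [set j])%:R.
Proof.
have -> : fourier kernel S = \sum_z \sum_(i in K) \sum_(j in K)
    #|K|%:R^-1 * chi R (symdiff S (symdiff [set i] [set j])) z.
  apply: eq_bigr => z _; rewrite /kernel expr2 mulr_suml mulrA mulrC mulr_sumr mulr_sumr.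
  apply: eq_bigr => i _; rewrite mulrCA mulr_sumr mulr_sumr mulr_sumr; apply: eq_bigr => j _.
  by rewrite -!chiM; ring.
rewrite exchange_big mulr_sumr /=; apply: eq_bigr => i _.
rewrite exchange_big mulr_sumr /=; apply: eq_bigr => j _.
rewrite -mulr_sumr sum_chi symdiff_eq0; case: eqP => _; rewrite ?mulr0 ?mulr1 //.
by rewrite mulrC.
Qed.

Lemma fourier_kernel_ge0 S : 0 <= fourier kernel S.
Proof.
rewrite fourier_kernel mulr_ge0 ?divr_ge0 ?exprn_ge0 //.
by apply: sumr_ge0 => i _; apply: sumr_ge0.
Qed.

Lemma fourier_kernel_oblivious S : S \in oblivious_sets n -> fourier kernel S = 0.
Proof.
rewrite inE => /andP[S0 S2]; rewrite fourier_kernel big1 ?mulr0 // => i _.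
rewrite big1 // => j _; case: eqP => // SE; move: S0 S2; rewrite SE.
case: (eqVneq i j) => [->|ij].
  by have := symdiff_eq0 [set j] [set j]; rewrite eqxx => /eqP ->; rewrite cards0.
have -> : symdiff [set i] [set j] = [set i; j].
  apply/finset.setP => l; rewrite !inE.
  by case: (eqVneq l i) => [->|] //=; rewrite (negPf ij).
by rewrite cards2 ij.
Qed.

Lemma sum_kernel : \sum_z kernel z = 2 ^+ n.
Proof.
have -> : \sum_z kernel z = fourier kernel finset.set0.
  by apply: eq_bigr => z _; rewrite chi0 mul1r.
rewrite fourier_kernel (_ : \sum_(i in K) _ = #|K|%:R).
  by rewrite divfK // K_card_neq0.
rewrite -sum1_card natr_sum; apply: eq_bigr => i iK.
rewrite (bigD1 i) //= eq_sym symdiff_eq0 eqxx big1 ?addr0 // => j /andP[_ /negPf ji].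
by rewrite eq_sym symdiff_eq0 (inj_eq finset.set1_inj) eq_sym ji.
Qed.

(** The ordered pairs [(a, b)] and [(b, a)] each contribute 1 to the double sum. *)
Lemma fourier_kernel_edge e : #|e| = 2%N -> e \subset K ->
  2 ^+ n * (2 / #|K|%:R) <= fourier kernel e.
Proof.
move=> /eqP/cards2P[a [b [ab ->]]]; rewrite finset.subUset !finset.sub1set => /andP[aK bK].
have abE : [set a; b] = symdiff [set a] [set b].
  apply/finset.setP => l; rewrite !inE.
  by case: (eqVneq l a) => [->|] //=; rewrite (negPf ab).
have baE : [set a; b] = symdiff [set b] [set a].
  by rewrite abE; apply/finset.setP => l; rewrite !inE addbC.
pose F i : R := \sum_(j in K) ([set a; b] == symdiff [set i] [set j])%:R.
have F0 i : 0 <= F i by apply: sumr_ge0.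
have F1 i j : j \in K -> [set a; b] = symdiff [set i] [set j] -> 1 <= F i.
  by move=> jK ij; rewrite /F (bigD1 j) //= -ij eqxx lerDl sumr_ge0.
rewrite fourier_kernel (_ : \sum_(i in K) _ = \sum_(i in K) F i) //.
rewrite mulrCA mulrC ler_wpM2l ?divr_ge0 ?exprn_ge0 //.
rewrite (bigD1 a) //= (bigD1 b) /=; last by rewrite bK eq_sym.
rewrite (_ : 2 = 1 + (1 + 0)); last by rewrite addr0.
rewrite !lerD ?(F1 a b) ?(F1 b a) //; apply: sumr_ge0 => i _; exact: F0.
Qed.

(** The law of the hidden state [y] under [P_x]: the input masked by independent noise of density
    [kernel]. *)
Definition posterior x y : R := kernel (shift x y) / 2 ^+ n.

Lemma posterior_ge0 x y : 0 <= posterior x y.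
Proof. by rewrite divr_ge0 ?kernel_ge0 ?exprn_ge0. Qed.

Lemma posterior_sum1 x : \sum_y posterior x y = 1.
Proof.
rewrite -mulr_suml; under eq_bigr do rewrite shiftC.
by rewrite (sum_shift x) sum_kernel divff // expf_neq0.
Qed.

Definition clique_prep x : fdist R (bits n) :=
  FDist (posterior_ge0 x) (posterior_sum1 x).

Variable guess : forall Mt : matching n, edge Mt.

Definition clique_meas (Mt : matching n) : finite_meas (bits n) :=
  existT (fun A : finType => bits n -> A) (edge Mt * bool)%type
    (fun y => (guess Mt, parity y (val (guess Mt)))).

Definition clique_protocol : hm_protocol (finite_theory R (bits n)) n :=
  @HMProtocol R (finite_theory R (bits n)) n clique_prep clique_meas
    (fun Mt => id) (fun Mt => inv_bij (f := id) (fun=> erefl)).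

(** For fixed [y], translation multiplies the coefficient of [kernel] at [S] by the sign [chi S y],
    so it still vanishes on oblivious sets. *)
Lemma clique_protocol_oblivious : parity_oblivious clique_protocol.
Proof.
move=> S hS M k; rewrite /prep_parity !prob_mix; apply/chi_sum_parity_class.
rewrite /= /finite_prob; under eq_bigr do rewrite mulr_sumr.
rewrite exchange_big big1 //= => y _.
under eq_bigr do rewrite mulrA mulrAC -mulrA.
transitivity ((tagged M y == k)%:R * (chi R S y / 2 ^+ n * fourier kernel S)).
  rewrite /fourier -[X in _ = _ * (_ * X)](sum_shift y) !mulr_sumr; apply: eq_bigr => x _.
  rewrite /posterior chi_shift.
  have := chi_sqr R S y; set c := chi R S y => c2.
  by rewrite -[LHS]mul1r -[X in X * _ = _]c2; ring.
by rewrite fourier_kernel_oblivious // !mulr0.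
Qed.

(** On edge [e] the answer is right exactly when the noise [shift x y] has even parity on [e], so
    the winning probability is the same for all inputs [x]. *)
Lemma clique_protocol_success : (0 < #|matching n|)%N ->
  p_succ clique_protocol = 1 / 2 + (2 * #|matching n|%:R)^-1 *
    \sum_(Mt : matching n) fourier kernel (val (guess Mt)) / 2 ^+ n.
Proof.
move=> M0; have N0 : #|matching n|%:R != 0 :> R by rewrite pnatr_eq0 -lt0n.
have E0 : 2 ^+ n != 0 :> R by rewrite expf_neq0.
rewrite /p_succ card_bits.
have win x (Mt : matching n) :
    \sum_(o : edge Mt * bool | o.2 == parity x (val o.1))
      prob (finite_theory R (bits n)) (hm_prep clique_protocol x) (hm_out clique_protocol o) =
    1 / 2 + fourier kernel (val (guess Mt)) / (2 * 2 ^+ n).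
  rewrite /= /finite_prob /=; set e := guess Mt.
  rewrite exchange_big /=.
  transitivity (\sum_y posterior x y * (1 + chi R (val e) (shift y x)) / 2).
    apply: eq_bigr => y _; rewrite -mulr_sumr -mulrA; congr (_ * _).
    rewrite big_mkcond (bigD1 (e, parity y (val e))) //= eqxx big1 => [|o oe].
      rewrite chi_shift /chi -signr_addb addr0.
      by case: (parity y _); case: (parity x _); rewrite /= ?expr0 ?expr1; field.
    by case: ifP => // _; case: eqP => // eo; rewrite -eo eqxx in oe.
  transitivity (\sum_z (kernel z / 2 ^+ n) * (1 + chi R (val e) z) / 2).
    by rewrite -[RHS](sum_shift x); apply: eq_bigr => y _; rewrite /posterior (shiftC x).
  transitivity ((\sum_z kernel z + fourier kernel (val e)) / (2 * 2 ^+ n)).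
    by rewrite -big_split mulr_suml /=; apply: eq_bigr => z _; field.
  by rewrite sum_kernel; field.
under eq_bigr => x _ do under eq_bigr => Mt _ do rewrite win.
rewrite sumr_const -[X in _ * X]mulr_natl card_bits big_split /= sumr_const -[X in X + _]mulr_natl.
have -> : \sum_Mt fourier kernel (val (guess Mt)) / (2 * 2 ^+ n) =
    2^-1 * \sum_Mt fourier kernel (val (guess Mt)) / 2 ^+ n.
  by rewrite mulr_sumr; apply: eq_bigr => Mt _; field.
by set X := \sum_Mt _; field; rewrite N0.
Qed.

End CliqueProtocol.

(** * The lower bound and the choice of the clique *)

Section LowerBound.
Variables (R : realType) (n : nat).

Lemma clique_guess (K : {set 'I_n}) : (0 < n)%N ->
  exists guess : forall Mt : matching n, edge Mt,
  forall Mt, hits K Mt -> val (guess Mt) \in pairs_in K.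
Proof.
move=> n0.
have h Mt : exists e : edge Mt, hits K Mt -> val e \in pairs_in K.
  case: (boolP (hits K Mt)) => [/exists_inP[e eK eM]|_].
    by exists (exist (fun e => e \in val Mt) e eM).
  (* For a matching without an edge inside [K], the edge at vertex 0 is the default. *)
  have [j _ jM] := matching_partner Mt (Ordinal n0).
  by exists (exist (fun e => e \in val Mt) _ jM).
exists (fun Mt => projT1 (cid (h Mt))) => Mt; exact: (projT2 (cid (h Mt))).
Qed.

(** A clique on [k] vertices, with [k] the integer square root of [n], is hit with probability at
    least [3 / 32], and a hit has bias at least [2 / k]; half their product is [3 / (32 k)]. *)
Lemma nc_protocol_exists : (3 < n)%N -> ~~ odd n ->
  exists (T : op_theory R) (pr : hm_protocol T n),
    [/\ admits_nc_model T, parity_oblivious pr &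
        1 / 2 + 3 / 32 * (Num.sqrt n%:R)^-1 <= p_succ pr].
Proof.
move=> n3 n_even.
have [k kn nk] : exists2 k, (k ^ 2 <= n)%N & (n < k.+1 ^ 2)%N.
  have ex : exists k, (k ^ 2 <= n)%N by exists 0%N.
  have ub k : (k ^ 2 <= n)%N -> (k <= n)%N by rewrite expnS expn1; nia.
  case: (ex_maxnP ex ub) => k kn kmax; exists k => //.
  by rewrite ltnNge; apply/negP => /kmax; rewrite ltnn.
have k2 : (1 < k)%N by move: nk; rewrite expnS expn1; nia.
have k1 : (0 < k)%N := ltnW k2.
have n0 : (0 < n)%N by apply: leq_trans n3.
have kltn : (k <= n)%N by move: kn; rewrite expnS expn1; nia.
pose K : {set 'I_n} := [set widen_ord kltn i | i : 'I_k].
have cK : #|K| = k.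
  by rewrite card_imset ?card_ord // => i j /(congr1 val) ij; exact: val_inj.
have K_neq0 : K != finset.set0 by rewrite -cards_eq0 cK -lt0n.
have [guess guessP] := clique_guess K n0.
have M0 := matching_exists n_even.
exists (finite_theory R (bits n)), (clique_protocol R K_neq0 guess); split.
- exact: finite_theory_nc [ffun=> false].
- exact: clique_protocol_oblivious.
rewrite clique_protocol_success //.
have E0 : 0 < 2 ^+ n :> R by rewrite exprn_gt0.
have k0 : 0 < k%:R :> R by rewrite ltr0n.
have N0 : 0 < #|matching n|%:R :> R by rewrite ltr0n.
have := @sum_hits_ge R n K n3; rewrite cK => /(_ kn k1).
set H := \sum_Mt (hits K Mt)%:R => hH.
have gain : 2 / k%:R * H <= \sum_Mt fourier (kernel R K) (val (guess Mt)) / 2 ^+ n.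
  rewrite mulr_sumr; apply: ler_sum => Mt _; rewrite ler_pdivlMr //.
  (* A default edge does no harm, because all coefficients of [kernel] are nonnegative. *)
  case: (boolP (hits K Mt)) => [/guessP|_]; last first.
    by rewrite mulr0 mul0r fourier_kernel_ge0.
  rewrite inE mulr1 mulrC -cK => /andP[eK /eqP e2].
  exact: fourier_kernel_edge.
have n10 : 0 < n.-1%:R :> R by rewrite ltr0n -subn1 subn_gt0 (ltn_trans _ n3).
(* [n - 1 <= k^2 + 2k - 1 <= 4k(k - 1)] for [k >= 2] *)
have kk : n.-1%:R <= 4 * (k * k.-1)%:R :> R.
  rewrite -natrM ler_nat; move: nk; rewrite expnS expn1.
  by case: k k2 {k1 kn kltn K cK K_neq0 guess guessP k0 gain hH H} => [|[|k]] //=; nia.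
(* Combines [3 k (k - 1) M <= 8 (n - 1) H], where [M] counts the matchings, with
   [n - 1 <= 4 k (k - 1)]. *)
have Hge : 3 / 32 * #|matching n|%:R <= H.
  rewrite -(ler_pM2l n10) mulrCA.
  have : 3 / 4 * (n.-1%:R * #|matching n|%:R) <= 8 * (n.-1%:R * H).
    apply: (@le_trans _ _ (3 * (k * k.-1)%:R * #|matching n|%:R)); last by rewrite mulrA.
    by rewrite mulrA ler_wpM2r ?(ltW N0) //; lra.
  by move: (_ * #|_|%:R) (_ * H) => a b; lra.
have ks : (Num.sqrt n%:R)^-1 <= k%:R^-1 :> R.
  rewrite lef_pV2 ?posrE ?sqrtr_gt0 ?ltr0n //.
  by rewrite -[leLHS](@ger0_norm _ k%:R) // -sqrtr_sqr ler_sqrt ?ler0n // -natrX ler_nat.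
rewrite lerD2l.
apply: (@le_trans _ _ (3 / 32 * k%:R^-1)); first by rewrite ler_wpM2l.
rewrite [leRHS]mulrC ler_pdivlMr ?mulr_gt0 //; apply: le_trans gain.
rewrite [leLHS](_ : _ = 2 / k%:R * (3 / 32 * #|matching n|%:R)); last by ring.
by rewrite ler_wpM2l // divr_ge0 // ltW.
Qed.

End LowerBound.

Theorem theorem4 (R : realType) :
  (forall (n : nat), (0 < n)%N -> ~~ odd n ->
    forall (T : op_theory R), admits_nc_model T ->
    forall (pr : hm_protocol T n), parity_oblivious pr ->
      p_succ pr <= 1 / 2 + 9 / Num.sqrt (n%:R - 1)) /\
  (exists (c C : R) (N : nat), [/\ 0 < c, 0 < C &
    forall n : nat, (N <= n)%N -> ~~ odd n ->
      1 / 2 + c * (Num.sqrt n%:R)^-1 <= p_nc_opt R n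
        <= 1 / 2 + C * (Num.sqrt n%:R)^-1]).
Proof.
have upper n : (0 < n)%N -> ~~ odd n ->
    forall (T : op_theory R), admits_nc_model T ->
    forall (pr : hm_protocol T n), parity_oblivious pr ->
      p_succ pr <= 1 / 2 + 9 / Num.sqrt (n%:R - 1).
  by case: n => [|[|n]] // _ _ T Tnc pr po; exact: nc_success_bound.
(* [18 = 2 * 9], as [n <= 4 (n - 1)] gives [sqrt n <= 2 sqrt (n - 1)]; the threshold 4 is that of
   [nc_protocol_exists]. *)
split=> //; exists (3 / 32), 18, 4%N; split; [lra | lra | move=> n n3 n_even].
have n0 : (0 < n)%N by exact: leq_trans n3.
have [T [pr [Tnc po pge]]] := nc_protocol_exists R n3 n_even.
rewrite /p_nc_opt; set A := (X in sup X).
(* [Apr] and [Aub] make the set nonempty and bounded above, so that [sup] is a genuine supremum and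
   not its default value. *)
have Apr : A (p_succ pr) by exists T, pr.
have Aub : ubound A (1 / 2 + 9 / Num.sqrt (n%:R - 1)).
  by move=> _ [T' [pr' [Tnc' po' ->]]]; exact: upper.
apply/andP; split.
  apply: le_trans pge _; apply: ub_le_sup => //.
  by exists (1 / 2 + 9 / Num.sqrt (n%:R - 1)).
apply: le_trans (sup_le_ub _ Aub) _; first by exists (p_succ pr).
rewrite lerD2l.
have n1 : 1 <= n%:R - 1 :> R by rewrite lerBrDr -(natrD _ 1 1) ler_nat; lia.
have s0 : 0 < Num.sqrt (n%:R - 1) :> R by rewrite sqrtr_gt0; lra.
have t0 : 0 < Num.sqrt n%:R :> R by rewrite sqrtr_gt0 ltr0n.
have : Num.sqrt n%:R <= 2 * Num.sqrt (n%:R - 1) :> R.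
  rewrite -[X in X * _](@ger0_norm _ 2) // -sqrtr_sqr -sqrtrM ?sqr_ge0 //.
  rewrite ler_sqrt; last by rewrite mulr_ge0 ?sqr_ge0 //; lra.
  rewrite expr2; lra.
move=> st; rewrite ler_pdivrMr // mulrAC ler_pdivlMr //; lra.
Qed.
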